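(* Let $n\ge1$ be an integer, $0<s<1$ and $u\in C_c^2(\mathbb{R}^n)$. Then for every fixed $x\in\mathbb{R}^n$, the map $t\mapsto(-\Delta)^tu(x)$ is $C^1$ on $(0,1)$, and $$\frac{d}{dt}(-\Delta)^tu(x)\Big|_{t=s}=c_{n,s}\,\mathcal{L}_1u(x)+b_{n,s}\,(-\Delta)^su(x),$$ where $$c_{n,s}=2^{2s}\pi^{-\frac n2}s\,\frac{\Gamma(\frac{n+2s}{2})}{\Gamma(1-s)},\qquad b_{n,s}=\frac{d}{ds}\ln c_{n,s}=\ln4+\frac1s+\psi(1-s)+\psi\Bigl(\frac{n+2s}{2}\Bigr),$$ $$\mathcal{L}_1u(x)=\mathrm{p.v.}\int_{\mathbb{R}^n}\frac{u(x)-u(y)}{|x-y|^{n+2s}}\bigl(-2\ln|x-y|\bigr)\,dy,$$ and $\psi=\Gamma'/\Gamma$ is the Digamma function.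
   Context: For $0<t<1$ and $u\in C_c^2(\mathbb{R}^n)$, the fractional Laplacian is $(-\Delta)^tu(x)=c_{n,t}\,\mathrm{p.v.}\int_{\mathbb{R}^n}\frac{u(x)-u(y)}{|x-y|^{n+2t}}\,dy$, where p.v. means $\lim_{\varepsilon\to0^+}\int_{|x-y|>\varepsilon}$ and $c_{n,t}$ is given by the displayed formula with $s$ replaced by $t$. *)

(* Defs.v *)
From HB Require Import structures.
From mathcomp Require Import all_boot all_order all_algebra.
From mathcomp Require Import all_classical all_reals all_analysis.

Set Implicit Arguments.
Unset Strict Implicit.
Unset Printing Implicit Defensive.

Import Order.TTheory GRing.Theory Num.Theory.
Import numFieldNormedType.Exports.

Local Open Scope classical_set_scope.
Local Open Scope ring_scope.

Section lebesgue_tuple.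
Variable R : realType.

Local Notation mR := (measurableTypeR R).

Definition cons_pair n (p : mR * n.-tuple mR) : n.+1.-tuple mR :=
  [tuple of p.1 :: p.2].

Definition uncons_pair n (t : n.+1.-tuple mR) : mR * n.-tuple mR :=
  (thead t, [tuple of behead t]).

Lemma measurable_cons_pair n : measurable_fun setT (@cons_pair n).
Proof. exact: measurable_cons. Qed.

Lemma measurable_uncons_pair n : measurable_fun setT (@uncons_pair n).
Proof.
apply/measurable_fun_pairP; split; first exact: (measurable_tnth ord0).
exact: measurable_behead.
Qed.

Lemma cons_pairK n : cancel (@cons_pair n) (@uncons_pair n).
Proof. by move=> [a t]; congr pair; apply/val_inj. Qed.

(* Lebesgue measure on R^n: the n-fold product of the Lebesgue measure of R. *)
Fixpoint lebesgue_tuple n : set (n.-tuple mR) -> \bar R :=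
  if n is k.+1 then
    pushforward (@lebesgue_measure R \x @lebesgue_tuple k)%E (@cons_pair k)
  else dirac [tuple].

Let is_sfm d (T : measurableType d) (mu : set T -> \bar R) :=
  [/\ mu set0 = 0%E, forall A, (0 <= mu A)%E, semi_sigma_additive mu
    & sigma_finite setT mu].

Let pushforward_sfm n (m : {measure set (mR * n.-tuple mR)%type -> \bar R}) :
  sigma_finite setT m -> is_sfm (pushforward m (@cons_pair n)).
Proof.
move=> [F FT Foo].
have mc A : measurable A -> measurable (@cons_pair n @^-1` A).
  by move=> mA; rewrite -[X in measurable X]setTI; exact: measurable_cons_pair.
split; rewrite /pushforward.
- by rewrite preimage_set0 measure0.
- by move=> A; exact: measure_ge0.
- move=> G mG tG mUG; rewrite preimage_bigcup.
  apply: measure_semi_sigma_additive => [k||]; first exact: mc.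
  + apply/trivIsetP => /= i j _ _ ij; rewrite -preimage_setI.
    by move/trivIsetP : tG => /(_ _ _ I I ij) ->; rewrite preimage_set0.
  + by rewrite -preimage_bigcup; exact: mc.
- exists (fun k => @uncons_pair n @^-1` F k).
    by rewrite -preimage_bigcup -FT.
  move=> k; have [mFk Fkoo] := Foo k; split.
    by rewrite -[X in measurable X]setTI; exact: measurable_uncons_pair.
  rewrite -comp_preimage (_ : _ \o _ = id) ?preimage_id//.
  by apply/funext => x /=; exact: cons_pairK.
Qed.

Let product_sigma_finite n
    (m : {sigma_finite_measure set (n.-tuple mR) -> \bar R}) :
  sigma_finite setT (@lebesgue_measure R \x m)%E.
Proof.
have /sigma_finiteP[F [TF ndF Foo]] := sigma_finiteT (@lebesgue_measure R).
have /sigma_finiteP[G [TG ndG Goo]] := sigma_finiteT m.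
exists (fun n => F n `*` G n).
  rewrite -setXTT TF TG predeqE => -[x y]; split.
    move=> [/= [i _ Fix] [j _ Gjy]]; exists (maxn i j) => //; split.
    - by move: x Fix; exact/subsetPset/ndF/leq_maxl.
    - by move: y Gjy; exact/subsetPset/ndG/leq_maxr.
  by move=> [i _ []/= ? ?]; split; exists i.
move=> k; have [? ?] := Foo k; have [? ?] := Goo k.
split; first exact: measurableX.
by rewrite product_measure1E// lte_mul_pinfty// ge0_fin_numE.
Qed.

Let lebesgue_tuple_sfm n : is_sfm (@lebesgue_tuple n).
Proof.
elim: n => [|n [m0 mge0 madd mfin]] /=.
  split; [exact: measure0 | exact: measure_ge0
         | exact: measure_semi_sigma_additive | exact: sigma_finiteT].
pose B1 := isMeasure.Build _ _ _ (@lebesgue_tuple n) m0 mge0 madd.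
pose M : {measure set (n.-tuple mR) -> \bar R} :=
  HB.pack (@lebesgue_tuple n) B1.
pose B2 := Measure_isSigmaFinite.Build _ _ _ M mfin.
pose S : {sigma_finite_measure set (n.-tuple mR) -> \bar R} :=
  HB.pack (@lebesgue_tuple n) B1 B2.
exact: (@pushforward_sfm n (@lebesgue_measure R \x S)%E (product_sigma_finite S)).
Qed.

Let lebesgue_tuple0 n : @lebesgue_tuple n set0 = 0%E.
Proof. by have [] := lebesgue_tuple_sfm n. Qed.

Let lebesgue_tuple_ge0 n A : (0 <= @lebesgue_tuple n A)%E.
Proof. by have [] := lebesgue_tuple_sfm n. Qed.

Let lebesgue_tuple_sigma_additive n : semi_sigma_additive (@lebesgue_tuple n).
Proof. by have [] := lebesgue_tuple_sfm n. Qed.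

Let lebesgue_tuple_sigma_finite n : sigma_finite setT (@lebesgue_tuple n).
Proof. by have [] := lebesgue_tuple_sfm n. Qed.

HB.instance Definition _ n := isMeasure.Build _ _ _ (@lebesgue_tuple n)
  (@lebesgue_tuple0 n) (@lebesgue_tuple_ge0 n)
  (@lebesgue_tuple_sigma_additive n).

HB.instance Definition _ n := Measure_isSigmaFinite.Build _ _ _
  (@lebesgue_tuple n) (@lebesgue_tuple_sigma_finite n).

End lebesgue_tuple.
Arguments lebesgue_tuple {R} n.

Section fractional_laplacian.
Context {R : realType}.

Definition vec_of_tuple n (t : n.-tuple (measurableTypeR R)) : 'rV[R]_n :=
  \row_i tnth t i.

(* The library's norm on ['rV[R]_n] is the sup norm. *)
Definition enorm n (x : 'rV[R]_n) : R := Num.sqrt (\sum_(i < n) x 0 i ^+ 2).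

Fixpoint is_Ck n (k : nat) (f : 'rV[R]_n -> R) : Prop :=
  if k is k'.+1 then
    continuous f /\
    forall i : 'I_n, (forall x, derivable f x (delta_mx 0 i)) /\
                     is_Ck k' (fun x => 'D_(delta_mx 0 i) f x)
  else continuous f.

Definition C2c n (u : 'rV[R]_n -> R) : Prop :=
  is_Ck 2 u /\ compact (closure [set x | u x != 0]).

Definition outside_ball n (x : 'rV[R]_n) (eps : R) :
    set (n.-tuple (measurableTypeR R)) :=
  [set t | eps < enorm (x - vec_of_tuple t)].

Definition truncated_integral n (f : 'rV[R]_n -> R) (x : 'rV[R]_n) (eps : R) : R :=
  \int[lebesgue_tuple n]_(t in outside_ball x eps) f (vec_of_tuple t).

Definition pv_integral n (f : 'rV[R]_n -> R) (x : 'rV[R]_n) : R :=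
  lim (truncated_integral f x eps @[eps --> 0^'+]).

(* [fine] and [lim] are total: this says that [pv_integral f x] is a genuine
   limit of genuine (absolutely convergent) integrals. *)
Definition pv_exists n (f : 'rV[R]_n -> R) (x : 'rV[R]_n) : Prop :=
  (forall eps, 0 < eps ->
     (lebesgue_tuple n).-integrable (outside_ball x eps)
       (fun t => (f (vec_of_tuple t))%:E)) /\
  cvg (truncated_integral f x eps @[eps --> 0^'+]).

(* Euler's integral, meaningful for [0 < z]. *)
Definition Gamma (z : R) : R :=
  \int[lebesgue_measure]_(t in `]0, +oo[) (t `^ (z - 1) * expR (- t)).

Definition digamma (z : R) : R := derive1 Gamma z / Gamma z.

Definition c_const (n : nat) (s : R) : R :=
  2 `^ (2 * s) * pi `^ (- (n%:R / 2)) * s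
    * (Gamma ((n%:R + 2 * s) / 2) / Gamma (1 - s)).

Definition b_const (n : nat) (s : R) : R := derive1 (fun t => ln (c_const n t)) s.

Definition frac_kernel n (s : R) (u : 'rV[R]_n -> R) (x y : 'rV[R]_n) : R :=
  (u x - u y) / enorm (x - y) `^ (n%:R + 2 * s).

Definition frac_laplacian n (s : R) (u : 'rV[R]_n -> R) (x : 'rV[R]_n) : R :=
  c_const n s * pv_integral (frac_kernel s u x) x.

Definition log_kernel n (s : R) (u : 'rV[R]_n -> R) (x y : 'rV[R]_n) : R :=
  frac_kernel s u x y * (- 2 * ln (enorm (x - y))).

Definition L1_op n (s : R) (u : 'rV[R]_n -> R) (x : 'rV[R]_n) : R :=
  pv_integral (log_kernel s u x) x.

End fractional_laplacian.

(* Main.v *)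
From HB Require Import structures.
Require Import Defs.
From mathcomp Require Import all_boot all_order all_algebra.
From mathcomp Require Import all_classical all_reals all_analysis.
From mathcomp Require Import measurable_realfun lebesgue_integral_under.
From mathcomp Require Import ring lra zify.
Import Order.TTheory GRing.Theory Num.Theory.
Import numFieldNormedType.Exports.
Local Open Scope classical_set_scope.
Local Open Scope ring_scope.

(** Write [r = |x - y|]. The kernel of [(-Delta)^t] factors as
    [(u x - u y) * r ^ (- n) * expR (t * (- 2 * ln r))], so that, apart from the
    constant [c_{n,t}], the operator is a Laplace transform in [t] with rate
    [- 2 ln r]; the kernel of [L_1] is what comes out when [t] is differentiated
    under the integral sign. Euler's integral is a Laplace transform too, with
    rate [ln], so a single lemma on differentiating
    [t |-> \int g * expR (t * l)] ([laplace_is_derive]) serves both for the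
    singular integral and for [Gamma]. It asks only that the integrand be
    integrable for each [t] in an open interval: since
    [|l| * expR (t * l) <= C * (expR ((t + d) * l) + expR ((t - d) * l))], the
    derivative is dominated locally uniformly, and as its integrand is again
    integrable for each [t] the lemma applies to it in turn, which makes the
    derivative continuous.

    The principal value is removed by symmetry. The reflection [y |-> 2 x - y]
    preserves Lebesgue measure and every [{ r > eps }], so each truncated
    integral is unchanged when the kernel is averaged with its reflection.
    For [u] of class C^2 the averaged numerator is the second difference
    [2 u x - u y - u (2 x - y)], which is [O (min 1 r^2)]; hence
    the averaged kernel is [O (min 1 r^2 * r ^ (- n - 2 t))], absolutely
    integrable on the whole space when [0 < t < 1], and dominated convergence
    turns the principal value into an ordinary integral ([pv_symmetrize]).

    Integrability of this power of [r] is reduced to one variable. The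
    function [weight a], for [0 < a <= 1], is decreasing, behaves like
    [r ^ (a - 1)] at [0] and like [r ^ (- a - 1)] at infinity, and is the
    derivative of a bounded function. Since [|x_i - y_i| <= r] for each [i],
    [weight a r ^ n] is at most the product of the [weight a |x_i - y_i|], whose
    integral is finite by Tonelli ([integrable_le_weight]).

    Finally [c_{n,t}] is differentiable with logarithmic derivative
    [ln 4 + 1/t + psi (1 - t) + psi ((n + 2 t) / 2)], which is continuous on
    (0, 1), and the product rule for [c_{n,t}] times the integral gives the
    formula. *)

Set Implicit Arguments.
Unset Strict Implicit.
Unset Printing Implicit Defensive.

(** * Differentiation of Laplace transforms under the integral sign *)

Section laplace.
Context {R : realType} d {T : measurableType d} (mu : {measure set T -> \bar R}).
Implicit Types (D : set T) (g l : T -> R).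

Lemma norm_le_expRD (x : R) : `|x| <= expR x + expR (- x).
Proof.
have := expR_ge1Dx x; have := expR_ge1Dx (- x).
have := expR_gt0 x; have := expR_gt0 (- x).
by case: (ger0P x) => _; lra.
Qed.

Lemma expR_le_expRD (a b c x : R) : a <= b <= c ->
  expR (b * x) <= expR (a * x) + expR (c * x).
Proof.
move=> /andP[ab bc]; have [x0|x0] := leP 0 x.
  by rewrite ler_wpDl ?expR_ge0// ler_expR ler_wpM2r.
by rewrite ler_wpDr ?expR_ge0// ler_expR ler_wnM2r// ltW.
Qed.

(** Multiplication by the rate [x] costs only an arbitrarily small change of the
    exponent: [d0 * |x| <= expR (d0 * x) + expR (- d0 * x)]. The exponents
    [t +- 2 * d0] absorb both this [d0] and the distance from [r] to [t], so the
    bound is uniform in [r]. *)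
Lemma norm_expR_le (d0 r t x : R) : 0 < d0 -> `|r - t| <= d0 ->
  `|x| * expR (r * x) <=
    2 / d0 * (expR ((t + 2 * d0) * x) + expR ((t - 2 * d0) * x)).
Proof.
move=> d00 rt.
have : d0 * `|x| <= expR (d0 * x) + expR (- (d0 * x)).
  by rewrite -{1}(gtr0_norm d00) -normrM norm_le_expRD.
move=> /(ler_wpM2r (expR_ge0 (r * x))); rewrite mulrDl -!expRD.
rewrite -mulNr -!mulrDl.
have := rt; rewrite ler_norml => /andP[rt1 rt2].
have h1 : t - 2 * d0 <= d0 + r <= t + 2 * d0 by lra.
have h2 : t - 2 * d0 <= - d0 + r <= t + 2 * d0 by lra.
have := expR_le_expRD x h1; have := expR_le_expRD x h2.
move=> e1 e2 e3.
have -> : forall S, 2 / d0 * S = (2 * S) / d0 by move=> S; rewrite mulrAC.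
by rewrite ler_pdivlMr// mulrC mulrA; lra.
Qed.

(** One integrable [G] dominates the derivative in the parameter for all
    [r] near [t]: the two exponents of [norm_expR_le] still lie in the
    interval of integrability when [d0] is a quarter of the distance from [t] to
    its endpoints. *)
Lemma laplace_locally_dominated D g l (a b t : R) : measurable D ->
  measurable_fun D g -> measurable_fun D l ->
  (forall t : R, a < t < b ->
     mu.-integrable D (fun y => (g y * expR (t * l y))%:E)) ->
  a < t < b ->
  exists d0 : R, exists G : T -> R,
   [/\ 0 < d0, a < t - d0 & t + d0 < b] /\
   [/\ (forall y, 0 <= G y),
       mu.-integrable D (EFin \o G) &
       forall r y, D y -> `|r - t| <= d0 ->
       `|g y * l y * expR (r * l y)| <= G y].
Proof.
move=> mD mg ml ig /andP[at_ tb].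
pose d0 := Num.min ((t - a) / 4) ((b - t) / 4).
have d00 : 0 < d0 by rewrite lt_min; apply/andP; split; lra.
have d1 : d0 <= (t - a) / 4 by rewrite ge_min lexx.
have d2 : d0 <= (b - t) / 4 by rewrite ge_min lexx orbT.
exists d0.
exists (fun y => 2 / d0 * (`|g y * expR ((t + 2 * d0) * l y)| +
                   `|g y * expR ((t - 2 * d0) * l y)|)).
split; first by split=> //; lra.
have h1 : a < t + 2 * d0 < b by lra.
have h2 : a < t - 2 * d0 < b by lra.
split=> [y||r y Dy rt].
- by rewrite mulr_ge0 ?addr_ge0 ?divr_ge0// ltW.
- have /integrable_abse i1 := ig _ h1.
  have /integrable_abse i2 := ig _ h2.
  have := integrableZl mD (2 / d0) (integrableD mD i1 i2).
  by apply: eq_integrable.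
- have := norm_expR_le (l y) d00 rt.
  move=> /(ler_wpM2l (normr_ge0 (g y))).
  rewrite !normrM !(ger0_norm (expR_ge0 _)) mulrA => /le_trans; apply.
  by rewrite -mulrDr mulrCA.
Qed.

Lemma laplace_integrable D g l (a b t : R) : measurable D ->
  measurable_fun D g -> measurable_fun D l ->
  (forall t : R, a < t < b ->
     mu.-integrable D (fun y => (g y * expR (t * l y))%:E)) ->
  a < t < b ->
  mu.-integrable D (fun y => (g y * l y * expR (t * l y))%:E).
Proof.
move=> mD mg ml ig abt.
have [d0 [G [[d00 _ _] [G0 iG GP]]]] := laplace_locally_dominated mD mg ml ig abt.
apply: (le_integrable mD _ _ iG).
  apply/measurable_EFinP; apply: measurable_funM; first exact: measurable_funM.
  by apply: measurableT_comp => //; exact: measurable_funM.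
move=> y Dy /=; rewrite lee_fin (ger0_norm (G0 _)) GP//.
by rewrite subrr normr0 ltW.
Qed.

Lemma laplace_is_derive D g l (a b t : R) : measurable D ->
  measurable_fun D g -> measurable_fun D l ->
  (forall t : R, a < t < b ->
     mu.-integrable D (fun y => (g y * expR (t * l y))%:E)) ->
  a < t < b ->
  is_derive t 1 (fun t => \int[mu]_(y in D) (g y * expR (t * l y)))
    (\int[mu]_(y in D) (g y * l y * expR (t * l y))).
Proof.
move=> mD mg ml ig abt.
have [d0 [G [[d00 da db] [G0 iG GP]]]] := laplace_locally_dominated mD mg ml ig abt.
have dE y (r : R) : is_derive r 1 (fun r => g y * expR (r * l y))
    (g y * l y * expR (r * l y)).
  have d1 := @is_deriveM _ _ id (cst (l y)) r 1 _ _ (is_derive_id r 1)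
    (is_derive_cst (l y) r 1).
  have {}d1 : is_derive r 1 (fun r : R => r * l y) (l y).
    by apply: (is_derive_eq d1); rewrite /GRing.scale /= mulr0 mulr1 add0r.
  have := is_deriveZ (g y) (@is_derive1_comp _ expR (fun r : R => r * l y) r _ _
    (is_derive_expR (r * l y)) d1).
  by move/is_derive_eq; apply; rewrite /GRing.scale /=; ring.
pose f (r : R) y := g y * expR (r * l y).
have pE r y : partial1of2 f r y = g y * l y * expR (r * l y).
  by rewrite partial1of2E; have [_ ->] := dE y r.
have It : `]t - d0, t + d0[%classic t by rewrite /= in_itv/=; lra.
have intf x : `]t - d0, t + d0[%classic x -> mu.-integrable D (EFin \o f x).
  by rewrite /= in_itv/= => tx; apply: ig; lra.
have derf x y : `]t - d0, t + d0[%classic x -> D y -> derivable (f ^~ y) x 1.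
  by move=> _ _; have [] := dE y x.
have Gub x y : `]t - d0, t + d0[%classic x -> D y -> `|partial1of2 f x y| <= G y.
  rewrite /= in_itv/= => tx Dy; rewrite pE GP// ler_norml; lra.
split.
  exact: (derivable_under_integral mD It intf derf G0 iG Gub).
have := differentiation_under_integral mD It intf derf G0 iG Gub.
rewrite derive1E => ->; apply: eq_Rintegral => y _.
by have := pE t y.
Qed.

(** The derivative is itself a Laplace transform, of [g * l], hence
    differentiable and so continuous. *)
Lemma laplace_derive_continuous D g l (a b t : R) : measurable D ->
  measurable_fun D g -> measurable_fun D l ->
  (forall t : R, a < t < b ->
     mu.-integrable D (fun y => (g y * expR (t * l y))%:E)) ->
  a < t < b ->
  {for t, continuous (fun t : R => \int[mu]_(y in D) (g y * l y * expR (t * l y)))}.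
Proof.
move=> mD mg ml ig abt; apply: differentiable_continuous.
apply/derivable1_diffP.
have igl r : a < r < b ->
    mu.-integrable D (fun y => (g y * l y * expR (r * l y))%:E).
  exact: laplace_integrable mD mg ml ig.
by have [] := laplace_is_derive mD (measurable_funM mg ml) ml igl abt.
Qed.
End laplace.

(** * An integrable weight on the half-line *)

Section weight.
Context {R : realType}.
Local Notation mu := (@lebesgue_measure R).
Local Notation mR := (measurableTypeR R).

(** The image measure agrees with Lebesgue measure on half-open intervals,
    which determine it. *)
Lemma lebesgue_measure_reflect (c : R) (A : set mR) : measurable A ->
  mu ((fun r => c - r) @^-1` A) = mu A.
Proof.
have mphi : measurable_fun [set: mR] (fun r : mR => c - r : mR).
  exact: measurable_funB.
pose mphi_mixin := isMeasurableFun.Build _ _ _ _ _ mphi.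
pose phi : {mfun mR >-> mR} := HB.pack (fun r : mR => c - r : mR) mphi_mixin.
move=> mA; apply/esym.
apply: (@lebesgue_measure_unique R (pushforward mu phi)) => // X [[a b] _ <-].
change (mu `]a, b]%classic = mu ((fun r : R => c - r) @^-1` `]a, b]%classic)).
have -> : (fun r : R => c - r) @^-1` `]a, b]%classic = `[c - b, c - a[%classic.
  by apply/seteqP; split => r /=; rewrite !in_itv/= => /andP[? ?];
    apply/andP; split; lra.
rewrite !lebesgue_measure_itv /= !lte_fin.
have -> : (c - b < c - a) = (a < b) by apply/idP/idP; lra.
by case: ifP => // _; rewrite -!EFinB; congr EFin; ring.
Qed.

Lemma ge0_integral_reflect (c : R) (D : set mR) (f : mR -> \bar R) :
  measurable D -> measurable_fun D f -> (forall y, D y -> 0 <= f y)%E ->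
  (\int[mu]_(r in (fun r : mR => (c - r)%R : mR) @^-1` D) f (c - r)%R =
   \int[mu]_(r in D) f r)%E.
Proof.
move=> mD mf f0.
have mphi : measurable_fun [set: mR] (fun r : mR => c - r : mR).
  exact: measurable_funB.
rewrite -(@ge0_integral_pushforward _ _ _ _ R _ mphi mu D f)//; last first.
  by move=> y; rewrite inE; exact: f0.
pose mphi_mixin := isMeasurableFun.Build _ _ _ _ _ mphi.
pose phi : {mfun mR >-> mR} := HB.pack (fun r : mR => c - r : mR) mphi_mixin.
apply: (@eq_measure_integral _ _ R D mu (pushforward mu phi) f) => A mA AD.
exact: lebesgue_measure_reflect.
Qed.

(** The derivative of [r |-> - (1 + r `^ a) `^ (- 1)] on the half-line. It
    is decreasing for [a <= 1], while its primitive is bounded, which is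
    what makes its integral easy to control at both ends at once. *)
Definition weight (a r : R) : R := a * r `^ (a - 1) * (1 + r `^ a) `^ (- 2).

Lemma weight_ge0 a r : 0 <= a -> 0 <= weight a r.
Proof. by move=> a0; rewrite !mulr_ge0 ?powR_ge0. Qed.

Lemma measurable_weight a : measurable_fun [set: R] (weight a).
Proof.
apply: measurable_funM.
  by apply: measurable_funM => //; exact: measurable_powR.
apply: (measurableT_comp (f := fun r : R => r `^ (- 2))).
  exact: measurable_powR.
by apply: measurable_funD => //; exact: measurable_powR.
Qed.

Lemma is_derive_powR_comp (f : R -> R) (df b x : R) : 0 < f x ->
  is_derive x 1 f df ->
  is_derive x 1 (fun x => f x `^ b) (b * f x `^ (b - 1) * df).
Proof.
move=> fx0 dfx; exact: (@is_derive1_comp _ (fun r => r `^ b) f x _ _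
   (is_derive1_powR b fx0) dfx).
Qed.

Lemma is_derive_1DpowR (a x : R) : 0 < x ->
  is_derive x 1 (fun r => 1 + r `^ a) (a * x `^ (a - 1)).
Proof.
move=> x0; have := is_deriveD (is_derive_cst (1 : R) x 1) (is_derive1_powR a x0).
by move/is_derive_eq; apply; rewrite add0r.
Qed.

Lemma is_derive_weight_primitive (a x : R) : 0 < x ->
  is_derive x 1 (fun r => - (1 + r `^ a) `^ (- 1)) (weight a x).
Proof.
move=> x0.
have p : 0 < 1 + x `^ a by rewrite ltr_pwDl// powR_ge0.
have := is_deriveN (@is_derive_powR_comp (fun r => 1 + r `^ a) _ (-1) x p
  (is_derive_1DpowR a x0)).
move/is_derive_eq; apply; rewrite /weight (_ : -1 - 1 = -2 :> R); last by ring.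
by ring.
Qed.

Lemma derivable_weight (a x : R) : 0 < x -> derivable (weight a) x 1.
Proof.
move=> x0.
have p : 0 < 1 + x `^ a by rewrite ltr_pwDl// powR_ge0.
have [+ _] := is_deriveM (is_deriveZ a (is_derive1_powR (a - 1) x0))
  (@is_derive_powR_comp (fun r => 1 + r `^ a) _ (-2) x p
    (is_derive_1DpowR a x0)).
by [].
Qed.

Lemma integral_weight_itv (a p q : R) : 0 < a -> 0 < p < q ->
  (\int[mu]_(r in `[p, q]) (weight a r)%:E <= 1)%E.
Proof.
move=> a0 /andP[p0 pq].
have pos x : x \in `[p, q] -> 0 < x by rewrite in_itv/=; lra.
have poso x : x \in `]p, q[ -> 0 < x by rewrite in_itv/=; lra.
have dc (x : R) : 0 < x -> {for x, continuous (fun r => - (1 + r `^ a) `^ (- 1))}.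
  move=> x0; apply: differentiable_continuous; apply/derivable1_diffP.
  by have [] := is_derive_weight_primitive a x0.
rewrite (@continuous_FTC2 _ _ (fun r => - (1 + r `^ a) `^ (- 1))) //.
- rewrite -EFinB lee_fin opprK.
  have h1 : (1 + p `^ a) `^ (-1) <= 1.
    rewrite powR_inv1 ?addr_ge0 ?powR_ge0//.
    by rewrite invf_le1 ?lerDl ?powR_ge0// ltr_pwDl// powR_ge0.
  by rewrite addrC lerBlDr (le_trans h1)// lerDl powR_ge0.
- apply: derivable_within_continuous => x xpq; apply: derivable_weight.
  exact: pos.
- split.
  + by move=> x xpq; have [] := is_derive_weight_primitive a (poso _ xpq).
  + by apply: cvg_at_right_filter; apply: dc.
  + by apply: cvg_at_left_filter; apply: dc; lra.
- move=> x xpq; rewrite derive1E.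
  by have [_ ->] := is_derive_weight_primitive a (poso _ xpq).
Qed.

(** The weight may blow up at [0], so its integral is taken as the limit of the
    integrals over the segments [[1/(k+2), k+2]], each bounded by the total
    variation of the primitive. *)
Lemma integral_weight (a : R) : 0 < a ->
  (\int[mu]_(r in `]0%R, +oo[) (weight a r)%:E <= 1)%E.
Proof.
move=> a0.
pose F (k : nat) : set R := `[k.+2%:R^-1, k.+2%:R]%classic.
have -> : `]0, +oo[%classic = \bigcup_k F k.
  apply/seteqP; split=> r.
    rewrite /= in_itv/= andbT => r0.
    have r1 : 0 <= r^-1 by rewrite invr_ge0 ltW.
    have := archi_boundP (ltW r0); have := archi_boundP r1.
    set A := Num.bound _; set B := Num.bound _ => A1 B1.
    exists (A + B)%N => //; rewrite /F /= in_itv/=; apply/andP; split.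
      rewrite invf_ple ?posrE//; apply: (le_trans (ltW A1)); rewrite ler_nat; lia.
    by apply: (le_trans (ltW B1)); rewrite ler_nat; lia.
  move=> [k _]; rewrite /F /= !in_itv/= andbT => /andP[+ _].
  by apply: lt_le_trans; rewrite invr_gt0.
have mw k : measurable_fun (F k : set mR) (fun r => (weight a r)%:E).
  by apply/measurable_EFinP; apply: measurable_funTS; exact: measurable_weight.
have ndF : nondecreasing_seq F.
  move=> j k jk; apply/subsetPset => r; rewrite /F /= !in_itv/= => /andP[r1 r2].
  apply/andP; split; last by rewrite (le_trans r2)// ler_nat; lia.
  by rewrite (le_trans _ r1)// lef_pV2 ?posrE// ler_nat; lia.
have mF k : measurable (F k : set mR) by exact: measurable_itv.
have w0 k x : F k x -> (0 <= (weight a x)%:E)%E.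
  by move=> _; rewrite lee_fin weight_ge0// ltW.
rewrite -(cvg_lim _ (@ge0_nondecreasing_set_cvg_integral _ mR R F _ mu ndF mF mw w0))//.
apply: lime_le.
  apply: ereal_nondecreasing_is_cvgn.
  exact: (@ge0_nondecreasing_set_nondecreasing_integral _ mR R F _ mu ndF mF mw w0).
apply: nearW => k; apply: integral_weight_itv => //.
by rewrite invr_gt0 ltr0n /= (@lt_trans _ _ 1)// ?ltr1n// invf_lt1// ltr1n.
Qed.
End weight.

(** * Tensor powers of the weight on R^n *)

Section tuple_weight.
Context {R : realType}.
Local Notation mu := (@lebesgue_measure R).
Local Notation mR := (measurableTypeR R).

(** Tonelli's theorem, splitting off the first coordinate. *)
Lemma ge0_integral_lebesgue_tupleS n (f : n.+1.-tuple mR -> \bar R) :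
  measurable_fun setT f -> (forall t, 0 <= f t)%E ->
  (\int[lebesgue_tuple n.+1]_t f t =
   \int[mu]_r \int[lebesgue_tuple n]_t f (cons_pair (r, t)))%E.
Proof.
move=> mf f0.
rewrite -[RHS](@fubini_tonelli1 _ _ mR (n.-tuple mR) R mu (lebesgue_tuple n)
  (fun p => f (cons_pair p))) //; last first.
  exact: measurableT_comp (@measurable_cons_pair R n).
have := @ge0_integral_pushforward _ _ _ _ R _ (@measurable_cons_pair R n)
  (mu \x lebesgue_tuple n)%E setT f measurableT mf.
by rewrite preimage_setT => <-.
Qed.

(** The even extension of the weight. The value at [0] is infinite so that
    [weight_le_eweight] holds even on the coordinate hyperplanes, with no need
    to discard a null set. *)
Definition eweight (a r : R) : \bar R :=
  if r == 0 then +oo%E else (weight a `|r|)%:E.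

Lemma eweight_ge0 a r : 0 <= a -> (0 <= eweight a r)%E.
Proof.
by move=> a0; rewrite /eweight; case: ifP => // _; rewrite lee_fin weight_ge0.
Qed.

Lemma measurable_eweight a : measurable_fun [set: mR] (eweight a : mR -> \bar R).
Proof.
apply: measurable_fun_ifT => //.
  exact: (@measurable_fun_eqr _ mR R setT id (cst 0)).
apply/measurable_EFinP; apply: measurableT_comp; first exact: measurable_weight.
exact: continuous_measurable_fun (@norm_continuous _ R).
Qed.

Lemma integral_eweight (a : R) : 0 < a -> (\int[mu]_r eweight a r < +oo)%E.
Proof.
move=> a0.
have pos : (\int[mu]_(r in `]0%R, +oo[) eweight a r < +oo)%E.
  rewrite (le_lt_trans _ (ltry 1))//.
  rewrite (le_trans _ (integral_weight a0))// le_eqVlt; apply/orP; left; apply/eqP.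
  apply: eq_integral => r; rewrite inE /= in_itv/= andbT => r0.
  by rewrite /eweight (gt_eqF r0) (gtr0_norm r0).
have mw D : measurable_fun D (eweight a : mR -> \bar R).
  by apply: measurable_funTS; exact: measurable_eweight.
have w0 r : (0 <= eweight a r)%E by exact/eweight_ge0/ltW.
have mi (i : interval R) : measurable ([set` i] : set mR) by exact: measurable_itv.
have E : [set: mR] = `]0, +oo[%classic `|` ~` `]0, +oo[%classic by rewrite setUv.
rewrite E ge0_integral_setU//; last 2 first.
- exact: measurableC.
- exact/disj_setPCl.
apply: lte_add_pinfty => //.
have -> : ~` `]0, +oo[%classic = (fun r : mR => 0 - r : mR) @^-1` `[0, +oo[%classic.
  apply/seteqP; split=> r /=; rewrite !in_itv/= !andbT.
    by move/negP; rewrite -leNgt sub0r oppr_ge0.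
  by move=> + /lt_geF; rewrite sub0r oppr_ge0 => ->.
rewrite (eq_integral (fun r : mR => eweight a (0 - r))); last first.
  by move=> r _; rewrite sub0r /eweight oppr_eq0 normrN.
rewrite ge0_integral_reflect// -integral_itv_obnd_cbnd; [exact: pos|exact: mw].
Qed.

(** The centre [c] is indexed by [nat], so that removing the first coordinate
    is just a shift of [c]. *)
Definition tuple_weight (a : R) n (c : nat -> R) (t : n.-tuple mR) : \bar R :=
  (\prod_(i < n) eweight a (c i - tnth t i)%R)%E.

Lemma tuple_weight_ge0 a n c (t : n.-tuple mR) : 0 <= a -> (0 <= tuple_weight a c t)%E.
Proof. by move=> a0; apply: prode_ge0 => i _; exact: eweight_ge0. Qed.

Lemma tuple_weight_cons a n c r (t : n.-tuple mR) :
  tuple_weight a c (cons_pair (r, t)) =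
  (eweight a (c 0%N - r)%R * tuple_weight a (fun i => c i.+1) t)%E.
Proof.
rewrite /tuple_weight big_ord_recl; apply: f_equal2.
  by rewrite /cons_pair tnth0.
by apply: eq_bigr => i _; rewrite tnthS lift0.
Qed.

Lemma measurable_tuple_weight a n c :
  measurable_fun setT (@tuple_weight a n c).
Proof.
rewrite /tuple_weight.
elim: (index_enum _) => [|i s ih].
  by under eq_fun do rewrite big_nil; exact: measurable_cst.
under eq_fun do rewrite big_cons /=.
apply: emeasurable_funM => //.
apply: (measurableT_comp (measurable_eweight a)).
apply: (@measurable_funB _ _ R setT (cst (c i)) (fun t => tnth t i)) => //.
exact: measurable_tnth.
Qed.

Lemma integral_tuple_weight (a : R) n c : 0 < a ->
  (\int[lebesgue_tuple n]_t tuple_weight a c t < +oo)%E.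
Proof.
move=> a0; elim: n c => [|n ih] c.
  under eq_integral do rewrite /tuple_weight big_ord0.
  by rewrite integral_cst// mul1e /= diracE in_setT ltry.
have tw0 m d (t : m.-tuple mR) : (0 <= tuple_weight a d t)%E.
  by apply: tuple_weight_ge0; exact: ltW.
rewrite ge0_integral_lebesgue_tupleS//; last exact: measurable_tuple_weight.
have ew0 r : (0 <= eweight a r)%E by exact/eweight_ge0/ltW.
under eq_integral => r _.
  under eq_integral do rewrite tuple_weight_cons.
  rewrite ge0_integralZl//; last exact: measurable_tuple_weight.
  over.
have mr : measurable_fun [set: mR] (fun r : mR => eweight a (c 0%N - r)).
  apply: (measurableT_comp (measurable_eweight a)).
  exact: (@measurable_funB _ _ R setT (cst (c 0%N)) id).
rewrite ge0_integralZr//; last exact: integral_ge0.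
have := @ge0_integral_reflect R (c 0%N) setT (eweight a) measurableT
  (measurable_eweight a) (fun r _ => ew0 r).
rewrite preimage_setT => ->.
by apply: lte_mul_pinfty; rewrite ?integral_ge0// ge0_fin_numE ?integral_ge0//
  integral_eweight.
Qed.

Lemma le_powR_antitone (b p q : R) : b <= 0 -> 0 < p -> p <= q ->
  q `^ b <= p `^ b.
Proof.
move=> b0 p0 pq; rewrite -(opprK b) !(powRN _ (- b)).
have q0 := lt_le_trans p0 pq.
rewrite lef_pV2 ?posrE ?powR_gt0//.
by apply: ge0_ler_powR; rewrite ?nnegrE ?oppr_ge0// ltW.
Qed.

Lemma weight_antitone (a p q : R) : 0 < a <= 1 -> 0 < p -> p <= q ->
  weight a q <= weight a p.
Proof.
move=> /andP[a0 a1] p0 pq.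
apply: ler_pM.
- by rewrite mulr_ge0 ?powR_ge0 ?(ltW a0).
- exact: powR_ge0.
- by rewrite ler_pM2l// le_powR_antitone// subr_le0.
- rewrite le_powR_antitone// ?ltr_pwDl// ?powR_ge0// lerD2l.
  by apply: ge0_ler_powR; rewrite ?nnegrE// ltW// (lt_le_trans p0).
Qed.

Lemma powR_le_weight01 (a r : R) : 0 < a -> 0 < r <= 1 ->
  r `^ (a - 1) <= 4 / a * weight a r.
Proof.
move=> a0 /andP[r0 r1]; rewrite /weight.
have -> : 4 / a * (a * r `^ (a - 1) * (1 + r `^ a) `^ (- 2)) =
  r `^ (a - 1) * (4 * (1 + r `^ a) `^ (- 2)).
  by field; rewrite gt_eqF.
rewrite ler_peMr ?powR_ge0// powRN powR_mulrn ?addr_ge0 ?powR_ge0//.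
have h0 := powR_ge0 r a.
have h : r `^ a <= 1.
  have := @ge0_ler_powR _ a (ltW a0) r 1; rewrite powR1 !nnegrE.
  by apply => //; exact: ltW.
rewrite ler_pdivlMr ?exprn_gt0//; [nra | lra].
Qed.

Lemma powR_le_weight1y (a r : R) : 0 < a -> 1 <= r ->
  r `^ (- a - 1) <= 4 / a * weight a r.
Proof.
move=> a0 r1; have r0 : 0 < r by exact: lt_le_trans r1.
rewrite /weight.
have -> : 4 / a * (a * r `^ (a - 1) * (1 + r `^ a) `^ (- 2)) =
  r `^ (a - 1) * (4 * (1 + r `^ a) `^ (- 2)).
  by field; rewrite gt_eqF.
have -> : - a - 1 = (a - 1) + - (a * 2) by ring.
rewrite powRD; last by rewrite (gt_eqF r0) implybT.
rewrite ler_wpM2l ?powR_ge0// !powRN powRrM !powR_mulrn ?addr_ge0 ?powR_ge0//.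
have h : 1 <= r `^ a by have := ler_powR r1 (ltW a0); rewrite powRr0.
rewrite ler_pdivlMr ?exprn_gt0//; last lra.
rewrite mulrC ler_pdivrMr ?exprn_gt0//; [nra | lra].
Qed.

Lemma enorm_ge0 n (x : 'rV[R]_n) : 0 <= enorm x.
Proof. exact: sqrtr_ge0. Qed.

Lemma ler_norm_enorm n (x : 'rV[R]_n) i : `|x 0 i| <= enorm x.
Proof.
rewrite -sqrtr_sqr ler_sqrt.
  by rewrite (bigD1 i)//= lerDl sumr_ge0// => j _; rewrite sqr_ge0.
by apply: sumr_ge0 => j _; rewrite sqr_ge0.
Qed.

Lemma weight_le_eweight (a : R) n (h : 'rV[R]_n) i : 0 < a <= 1 ->
  ((weight a (enorm h))%:E <= eweight a (h 0%R i))%E.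
Proof.
move=> a01; rewrite /eweight; case: eqVneq => [_|h0]; first exact: leey.
by rewrite lee_fin weight_antitone// ?normr_gt0// ler_norm_enorm.
Qed.

Lemma measurable_enorm n (x : 'rV[R]_n) :
  measurable_fun setT (fun t : n.-tuple mR => enorm (x - vec_of_tuple t)).
Proof.
apply: measurableT_comp; first exact: continuous_measurable_fun (@sqrt_continuous R).
apply: (measurable_sum _ (h := fun i t => (x - vec_of_tuple t) 0 i ^+ 2)) => i.
apply: measurable_funX.
under eq_fun do rewrite !mxE.
apply: (@measurable_funB _ _ R setT (cst (x 0 i)) (fun t => tnth t i)) => //.
exact: measurable_tnth.
Qed.

(** Each coordinate of a vector is bounded by its Euclidean norm and the weight
    is decreasing, so [weight a |h| ^+ n] is bounded by the product of the
    weights of the coordinates of [h]. *)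
Lemma integrable_le_weight n (x : 'rV[R]_n) (a C : R) (D : set (n.-tuple mR))
    (h : n.-tuple mR -> R) :
  0 < a <= 1 -> 0 <= C -> measurable D -> measurable_fun D h ->
  (forall t, D t -> `|h t| <= C * weight a (enorm (x - vec_of_tuple t)) ^+ n) ->
  (lebesgue_tuple n).-integrable D (fun t => (h t)%:E).
Proof.
move=> a01 C0 mD mh hle; have /andP[a0 a1] := a01.
(* [tuple_weight] takes a [nat]-indexed centre; [0] is a default value *)
pose c k : R := if insub k is Some i then x 0 i else 0.
have cE (i : 'I_n) : c i = x 0 i by rewrite /c valK.
have tw0 t : (0 <= @tuple_weight a n c t)%E by apply: tuple_weight_ge0; exact: ltW.
have mtw : measurable_fun D (@tuple_weight a n c).
  by apply: measurable_funTS; exact: measurable_tuple_weight.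
apply/integrableP; split; first exact/measurable_EFinP.
apply: (@le_lt_trans _ _ (\int[lebesgue_tuple n]_(t in D)
    (C%:E * tuple_weight a c t))%E).
  apply: ge0_le_integral => //.
  - by apply/measurable_EFinP/measurableT_comp.
  - by apply: emeasurable_funM => //; exact: measurable_cst.
  - move=> t Dt; rewrite /=.
    apply: (@le_trans _ _ (C * weight a (enorm (x - vec_of_tuple t)) ^+ n)%:E).
      by rewrite lee_fin hle.
    rewrite EFinM; apply: lee_wpmul2l; first by rewrite lee_fin.
    rewrite -[X in _ ^+ X](card_ord n) -prodr_const -prodEFin.
    suff : (0 <= \prod_(i < n) (weight a (enorm (x - vec_of_tuple t)))%:E /\
      \prod_(i < n) (weight a (enorm (x - vec_of_tuple t)))%:E <=
      tuple_weight a c t)%E by case.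
    apply: (big_ind2 (fun p q => 0 <= p /\ p <= q)%E) => //.
    + by move=> p1 p2 q1 q2 [p10 p12] [q10 q12]; split;
        [exact: mule_ge0|exact: lee_pmul].
    + move=> i _; split; first by rewrite lee_fin; apply: weight_ge0; exact: ltW.
      have := @weight_le_eweight a n (x - vec_of_tuple t) i a01.
      by rewrite !mxE cE.
rewrite ge0_integralZl//.
apply: lte_mul_pinfty => //.
apply: le_lt_trans (integral_tuple_weight n c a0).
apply: ge0_subset_integral => //; exact: measurable_tuple_weight.
Qed.
End tuple_weight.

(** * Reflection invariance and principal values *)

Section reflection.
Context {R : realType}.
Local Notation mu := (@lebesgue_measure R).
Local Notation mR := (measurableTypeR R).

Definition tuple_reflect n (c : nat -> R) (t : n.-tuple mR) : n.-tuple mR :=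
  [tuple c i - tnth t i | i < n].

Lemma measurable_tuple_reflect n c : measurable_fun setT (@tuple_reflect n c).
Proof.
apply/measurable_fun_tnthP => i.
rewrite (_ : _ \o _ = fun t => c i - tnth t i); last first.
  by apply/funext => t; rewrite /= tnth_mktuple.
apply: (@measurable_funB _ _ R setT (cst (c i)) (fun t => tnth t i)) => //.
exact: measurable_tnth.
Qed.

Lemma tuple_reflect_cons n c r (t : n.-tuple mR) :
  tuple_reflect c (cons_pair (r, t)) =
  cons_pair ((c 0%N - r : mR), tuple_reflect (fun i => c i.+1) t).
Proof.
apply: eq_from_tnth => i; rewrite tnth_mktuple.
case: (unliftP ord0 i) => [j ->|->]; last by rewrite !tnth0.
by rewrite !tnthS tnth_mktuple lift0.
Qed.

(** Induction on the dimension: the first coordinate is reflected by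
    [ge0_integral_reflect], the others by the induction hypothesis. *)
Lemma ge0_integral_tuple_reflectT n c (f : n.-tuple mR -> \bar R) :
  measurable_fun setT f -> (forall t, 0 <= f t)%E ->
  (\int[lebesgue_tuple n]_t f (tuple_reflect c t) =
   \int[lebesgue_tuple n]_t f t)%E.
Proof.
elim: n c f => [|n ih] c f mf f0.
  by apply: eq_integral => t _; rewrite tuple0 [t]tuple0.
have mfr : measurable_fun setT (fun t => f (tuple_reflect c t)).
  exact: measurableT_comp mf (measurable_tuple_reflect _).
rewrite (ge0_integral_lebesgue_tupleS mfr (fun t => f0 _)).
rewrite (ge0_integral_lebesgue_tupleS mf f0).
have mfc : measurable_fun setT (fun p => f (@cons_pair R n p)).
  exact: measurableT_comp mf (@measurable_cons_pair R n).
have := @ge0_integral_reflect R (c 0%N) setT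
  (fun r => \int[lebesgue_tuple n]_t f (cons_pair (r, t)))%E measurableT
  (@measurable_fun_fubini_tonelli_F _ _ mR (n.-tuple mR) R (lebesgue_tuple n)
    _ mfc (fun p => f0 _)).
rewrite preimage_setT => <-; last first.
  by move=> r _; apply: integral_ge0 => t _; exact: f0.
apply: eq_integral => r _.
rewrite -(ih (fun i => c i.+1) (fun t => f (cons_pair (c 0%N - r, t))))//.
  by apply: eq_integral => t _; rewrite tuple_reflect_cons.
apply: (measurableT_comp mfc); exact: pair1_measurable.
Qed.

(** Restriction to the invariant set [D] and the decomposition into positive and
    negative parts reduce this to the previous case. *)
Lemma integral_tuple_reflect n c (D : set (n.-tuple mR)) (f : n.-tuple mR -> \bar R) :
  measurable D -> tuple_reflect c @^-1` D = D -> measurable_fun D f ->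
  (\int[lebesgue_tuple n]_(t in D) f (tuple_reflect c t) =
   \int[lebesgue_tuple n]_(t in D) f t)%E.
Proof.
move=> mD cD mf.
have cDE t : (tuple_reflect c t \in D) = (t \in D).
  by rewrite -{2}cD; apply/idP/idP; rewrite !inE.
have ge0 g : measurable_fun D g -> (forall t, 0 <= g t)%E ->
  (\int[lebesgue_tuple n]_(t in D) g (tuple_reflect c t) =
   \int[lebesgue_tuple n]_(t in D) g t)%E.
  move=> mg g0; rewrite integral_mkcond [RHS]integral_mkcond.
  rewrite -(@ge0_integral_tuple_reflectT n c (g \_ D)).
  - by apply: eq_integral => t _; rewrite !patchE cDE.
  - exact/(measurable_restrictT _ mD).
  - by move=> t; rewrite patchE; case: ifP.
rewrite integralE [RHS]integralE; congr (_ - _)%E.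
- rewrite -(ge0 f^\+%E (measurable_funepos mf) (funepos_ge0 f)).
  by rewrite (funepos_comp f (@tuple_reflect n c)).
- rewrite -(ge0 f^\-%E (measurable_funeneg mf) (funeneg_ge0 f)).
  by rewrite (funeneg_comp f (@tuple_reflect n c)).
Qed.

Lemma integrable_tuple_reflect n c (D : set (n.-tuple mR)) (f : n.-tuple mR -> \bar R) :
  measurable D -> tuple_reflect c @^-1` D = D ->
  (lebesgue_tuple n).-integrable D f ->
  (lebesgue_tuple n).-integrable D (f \o tuple_reflect c).
Proof.
move=> mD cD /integrableP[mf If]; apply/integrableP; split.
  apply: (measurable_comp mD _ mf).
    by move=> _ [t Dt <-]; move: Dt; rewrite -{1}cD.
  by apply: measurable_funTS; exact: measurable_tuple_reflect.
rewrite (@integral_tuple_reflect n c D (fun t => `|f t|%E))//.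
exact: measurableT_comp.
Qed.
End reflection.

Section principal_value.
Context {R : realType}.
Local Notation mR := (measurableTypeR R).
Context (n : nat) (x : 'rV[R]_n).
Local Notation mu := (@lebesgue_tuple R n).
Implicit Types (t : n.-tuple mR) (k : 'rV[R]_n -> R).

Definition symmetrize k (y : 'rV[R]_n) : R := (k y + k (2 *: x - y)) / 2.

Lemma measurable_outside_ball (e : R) : measurable (outside_ball x e).
Proof.
rewrite -[X in measurable X]setTI.
have := @measurable_enorm R n x measurableT `]e, +oo[%classic (measurable_itv _).
congr measurable; apply/seteqP; split => t /=; rewrite in_itv/= andbT//.
Qed.

Let center (j : nat) : R := if (insub j : option 'I_n) is Some i then 2 * x 0 i else 0.
Local Notation refl := (@tuple_reflect R n center).

Let vec_reflect t : vec_of_tuple (refl t) = 2 *: x - vec_of_tuple t.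
Proof. by apply/rowP => i; rewrite !mxE tnth_mktuple /center valK. Qed.

Lemma enormN (y : 'rV[R]_n) : enorm (- y) = enorm y.
Proof. by congr Num.sqrt; apply: eq_bigr => i _; rewrite mxE sqrrN. Qed.

Lemma enorm_reflect (y : 'rV[R]_n) : enorm (x - (2 *: x - y)) = enorm (x - y).
Proof.
by rewrite -enormN; congr enorm; apply/rowP => i; rewrite !mxE; ring.
Qed.

Let outside_ball_reflect e : refl @^-1` outside_ball x e = outside_ball x e.
Proof.
by apply/seteqP; split => t; rewrite /outside_ball /= vec_reflect enorm_reflect.
Qed.

(** The complement of a ball centred at [x] is invariant under the reflection
    about [x]. *)
Lemma truncated_integral_symmetrize k e :
  mu.-integrable (outside_ball x e) (fun t => (k (vec_of_tuple t))%:E) ->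
  truncated_integral k x e =
  \int[mu]_(t in outside_ball x e) symmetrize k (vec_of_tuple t).
Proof.
have mo := measurable_outside_ball e.
move=> ik; have ik' := integrable_tuple_reflect mo (outside_ball_reflect e) ik.
have E : \int[mu]_(t in outside_ball x e) k (vec_of_tuple (refl t)) =
         \int[mu]_(t in outside_ball x e) k (vec_of_tuple t).
  congr fine; apply: (integral_tuple_reflect mo (outside_ball_reflect e)
    (f := fun t => (k (vec_of_tuple t))%:E)).
  by case/integrableP: ik.
rewrite /symmetrize.
under eq_Rintegral => t _ do rewrite mulrC -vec_reflect.
rewrite RintegralZl//; last first.
  by have := integrableD mo ik ik'; apply: eq_integrable.
have half (r : R) : r = 2^-1 * (r + r) by field.
by rewrite RintegralD// E; exact: half.
Qed.

(** Dominated convergence, with the symmetrized kernel as its own dominating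
    function. At [y = x], outside every truncated domain, the limit is right
    because [k x = 0]. *)
Lemma pv_symmetrize k : k x = 0 ->
  (forall e, 0 < e ->
    mu.-integrable (outside_ball x e) (fun t => (k (vec_of_tuple t))%:E)) ->
  mu.-integrable setT (fun t => (symmetrize k (vec_of_tuple t))%:E) ->
  pv_exists k x /\
  pv_integral k x = \int[mu]_t symmetrize k (vec_of_tuple t).
Proof.
move=> kx ik isk.
pose S t := symmetrize k (vec_of_tuple t).
have mS : measurable_fun setT (fun t => (S t)%:E) by case/integrableP: isk.
have cv : truncated_integral k x e @[e --> 0^'+] --> \int[mu]_t S t.
  apply/cvg_at_rightP => e [e0 ecv].
  have -> : (fun i => truncated_integral k x (e i)) =
      fun i => \int[mu]_t (S \_ (outside_ball x (e i))) t.
    apply/funext => i; rewrite truncated_integral_symmetrize; last exact: ik.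
    exact: Rintegral_mkcond.
  apply: fine_cvg; rewrite fineK; last first.
    exact: (integrable_fin_num measurableT isk).
  have := @dominated_cvg _ _ R mu setT measurableT
    (fun i t => ((S \_ (outside_ball x (e i))) t)%:E) (fun t => (S t)%:E)
    (fun t => `|S t|%:E).
  apply.
  - move=> i; apply/measurable_EFinP.
    apply/(measurable_restrictT _ (measurable_outside_ball _)).
    by apply: measurable_funTS; apply/measurable_EFinP.
  - move=> t _.
    (* off [x] the indicator is eventually [1]; at [x] both sides are [0] *)
    have [xt|xt] := eqVneq x (vec_of_tuple t).
      have S0 : S t = 0.
        rewrite /S -xt /symmetrize kx add0r.
        by rewrite (_ : 2 *: x - x = x) ?kx ?mul0r// scaler_nat mulr2n addrK.
      have -> : (fun i => ((S \_ (outside_ball x (e i))) t)%:E) = cst (0 : R)%:E.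
        by apply/funext => i; rewrite patchE S0; case: ifP.
      by rewrite S0; exact: cvg_cst.
    apply: cvg_near_cst.
    have p : 0 < enorm (x - vec_of_tuple t).
      rewrite lt_neqAle enorm_ge0 andbT eq_sym; apply: contraNneq xt => x0.
      apply/eqP/rowP => i; apply/eqP; rewrite -subr_eq0 -normr_le0 -x0.
      by have := ler_norm_enorm (x - vec_of_tuple t) i; rewrite !mxE.
    move/cvgrPdist_lt : ecv => /(_ _ p); apply: filterS => i.
    rewrite sub0r normrN gtr0_norm// => ei.
    by rewrite patchE mem_set.
  - by [].
  - exact: integrable_norm.
  - move=> i t _; rewrite lee_fin patchE; case: ifP => // _; by rewrite normr0.
split; last exact: cvg_lim.
by split=> //; apply/cvg_ex; eexists; exact: cv.
Qed.
End principal_value.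

(** * Measurability of continuous functions and second differences *)

Section measurable_vec.
Context {R : realType}.
Local Notation mR := (measurableTypeR R).

Lemma nbhs_rV n (y : 'rV[R]_n) (P : set 'rV[R]_n) : nbhs y P ->
  exists2 e : R, 0 < e & forall z : 'rV[R]_n, (forall i, `|z 0 i - y 0 i| < e) -> P z.
Proof.
move=> /nbhs_ballP [e /= e0 eP]; exists e => // z zy.
apply: eP; split => // i j; rewrite (ord1 i).
by rewrite /ball /= distrC.
Qed.

(** Rounding every coordinate down to a multiple of [1/(k+1)] turns [f] into a
    function constant on each of countably many boxes, hence measurable; by
    continuity these functions converge to [f]. *)
Lemma measurable_continuous_vec n (f : 'rV[R]_n -> R) : continuous f ->
  measurable_fun setT (fun t : n.-tuple mR => f (vec_of_tuple t)).
Proof.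
move=> cf.
pose q (k : nat) (z : n.-tuple int) : 'rV[R]_n := \row_i ((tnth z i)%:~R / k.+1%:R).
pose fl (k : nat) (t : n.-tuple mR) : n.-tuple int :=
  [tuple Num.floor (k.+1%:R * tnth t i : R) | i < n].
apply: (@measurable_fun_cvg _ _ _ _ (fun k t => f (q k (fl k t)))) => [k|t _].
- move=> _ Y _; rewrite setTI.
  have -> : (fun t => f (q k (fl k t))) @^-1` Y =
      \bigcup_(z : n.-tuple int) ([set t | fl k t = z] `&` [set t | Y (f (q k z))]).
    apply/seteqP; split=> [t Yt|t [z _ [/= <-]]//].
    by exists (fl k t).
  apply: countable_bigcupT_measurable; first exact: countableP.
  move=> z; have [Yz|Yz] := pselect (Y (f (q k z))); last first.
    by rewrite (_ : _ `&` _ = set0)//; apply/seteqP; split=> // t [].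
  rewrite (_ : _ `&` _ = \big[setI/setT]_(i < n)
    ((fun t : n.-tuple mR => tnth t i) @^-1` `[(tnth z i)%:~R / k.+1%:R,
                      (tnth z i + 1)%:~R / k.+1%:R[%classic)); last first.
    have k0 : (0 : R) < k.+1%:R by rewrite ltr0n.
    rewrite -bigcap_seq; apply/seteqP; split => [t [/= <- _] i _|t /= zt].
      rewrite /= tnth_mktuple in_itv/=.
      rewrite ler_pdivrMr// ltr_pdivlMr// ![tnth t i * _]mulrC.
      exact: floor_itv.
    split=> //; apply: eq_from_tnth => i; rewrite tnth_mktuple.
    apply/floor_def; have := zt i (mem_index_enum _).
    by rewrite /= in_itv/= ler_pdivrMr// ltr_pdivlMr// ![tnth t i * _]mulrC.
  apply: bigsetI_measurable => i _.
  rewrite -[X in measurable X]setTI.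
  exact: (@measurable_tnth _ mR n i measurableT _ (measurable_itv _)).
- apply/cvgrPdist_lt => e e0.
  have /cvgrPdist_lt/(_ _ e0)/nbhs_rV[d d0 dP] := cf (vec_of_tuple t).
  near=> k; apply: dP => i; rewrite !mxE tnth_mktuple.
  have k0 : (0 : R) < k.+1%:R by rewrite ltr0n.
  have /andP[h1 h2] := floor_itv (k.+1%:R * tnth t i : R).
  rewrite intrD in h2.
  (* the mesh [1/(k+1)] is eventually smaller than [d] *)
  have kd : 1 < d * k.+1%:R.
    rewrite -ltr_pdivrMl// mulr1.
    near: k; exists (Num.bound d^-1) => // k /= dk.
    apply: (@lt_le_trans _ _ (Num.bound d^-1)%:R).
      by apply: archi_boundP; rewrite invr_ge0 ltW.
    by rewrite ler_nat; exact: leq_trans dk _.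
  rewrite -(ltr_pM2r k0) -[X in `|_| * X](gtr0_norm k0) -normrM mulrBl divfK ?gt_eqF//.
  rewrite ltr_norml; apply/andP; split; nra.
Unshelve. all: by end_near. Qed.
End measurable_vec.

Section second_difference.
Context {R : realType}.
Context (n : nat).
Implicit Types (f u : 'rV[R]_n -> R) (x y h v : 'rV[R]_n).

Lemma is_derive_line f x v (r : R) : derivable f (x + r *: v) v ->
  is_derive r 1 (fun r => f (x + r *: v)) ('D_v f (x + r *: v)).
Proof.
have E : (fun h : R => h^-1 *: (((fun r => f (x + r *: v)) \o shift r) (h *: 1) -
    f (x + r *: v))) =
  (fun h : R => h^-1 *: ((f \o shift (x + r *: v)) (h *: v) - f (x + r *: v))).
  apply/funext => h; congr (_ *: (f _ - _)).
  by rewrite /= scalerDl addrCA /GRing.scale/= mulr1.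
by move=> df; split; rewrite /derivable /derive E.
Qed.

Lemma MVT_line f x v (c : R) : (forall y, derivable f y v) ->
  exists2 r : R, `|r| <= `|c| & f (x + c *: v) - f x = c * 'D_v f (x + r *: v).
Proof.
move=> df; pose g (r : R) := f (x + r *: v).
have dg (r : R) : is_derive r 1 g ('D_v f (x + r *: v)) by exact: is_derive_line.
have cg (i : interval R) : {within [set` i], continuous g}.
  by apply: derivable_within_continuous => r _; have [] := dg r.
have g0 : g 0 = f x by rewrite /g scale0r addr0.
have [c0|c0] := leP 0 c.
- have [r + E] := MVT_segment c0 (fun r _ => dg r) (cg _).
  rewrite in_itv/= => /andP[r0 rc]; exists r; first by rewrite !ger0_norm.
  by rewrite -g0 -/(g c) E subr0 mulrC.
- have [r + E] := MVT_segment (ltW c0) (fun r _ => dg r) (cg _).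
  rewrite in_itv/= => /andP[r0 rc]; exists r.
    by rewrite !ler0_norm ?lerN2// ltW.
  by rewrite -g0 -/(g c) -opprB E sub0r mulrN opprK mulrC.
Qed.

(** The mean value theorem is applied on each segment of the path from [x] to
    [x + h] that moves along the coordinate directions one after the other;
    this path stays in the box spanned by [x] and [x + h]. *)
Lemma MVT_coordinates f x h :
  (forall i y, derivable f y (delta_mx 0 i)) ->
  exists xi : 'I_n -> 'rV[R]_n,
    (forall i j, `|xi i 0 j - x 0 j| <= `|h 0 j|) /\
    f (x + h) - f x = \sum_(i < n) h 0 i * 'D_(delta_mx 0 i) f (xi i).
Proof.
move=> df.
(* [p k] moves only the first [k] coordinates *)
pose p (k : nat) : 'rV[R]_n := \row_j (x 0 j + if (j < k)%N then h 0 j else 0).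
have pS (i : 'I_n) : p i.+1 = p i + h 0 i *: delta_mx 0 i.
  apply/rowP => j; rewrite !mxE eqxx/= ltnS leq_eqVlt -addrA; congr (_ + _).
  have [->|ji] := eqVneq j i; first by rewrite eqxx ltnn add0r mulr1.
  by rewrite (negbTE (ji : nat_of_ord j != i)) mulr0 addr0.
have /choice[xi xiP] : forall i : 'I_n, exists y, (forall j, `|y 0 j - x 0 j| <= `|h 0 j|) /\
    f (p i.+1) - f (p i) = h 0 i * 'D_(delta_mx 0 i) f y.
  move=> i.
  have [r rh E] := MVT_line (p i) (h 0 i) (df i).
  exists (p i + r *: delta_mx 0 i); split; last by rewrite pS E.
  move=> j; rewrite !mxE eqxx/=.
  have [->|ji] := eqVneq j i; first by rewrite ltnn addr0 mulr1 addrAC subrr add0r.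
  by rewrite mulr0 addr0 addrAC subrr add0r; case: ifP; rewrite ?normr0.
exists xi; split=> [i j|]; first by have [] := xiP i.
rewrite (eq_bigr (fun i : 'I_n => f (p i.+1) - f (p i))); last first.
  by move=> i _; have [_ ->] := xiP i.
rewrite -(big_mkord xpredT (fun k => f (p k.+1) - f (p k))) telescope_sumr//.
congr (f _ - f _); apply/rowP => j; rewrite !mxE ?ltn_ord//.
by rewrite addr0.
Qed.

Lemma ler_sum2 (a : 'I_n -> 'I_n -> R) i j : (forall i j, 0 <= a i j) ->
  a i j <= \sum_i \sum_j a i j.
Proof.
move=> a0; rewrite (bigD1 i)//= (bigD1 j)//= -addrA lerDl.
by rewrite addr_ge0// ?sumr_ge0// => k _; rewrite sumr_ge0.
Qed.

Lemma ler_norm_near (a b M : R) : `|a| <= M - 1 -> `|a - b| < 1 -> `|b| <= M.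
Proof.
rewrite ler_norml ltr_norml => /andP[? ?] /andP[? ?].
by rewrite ler_norml; apply/andP; split; lra.
Qed.

(** The first-order terms at [x + h] and [x - h] cancel up to the variation of
    the first partial derivatives, which is [O(|h|)] because the second ones are
    continuous, hence bounded near [x]. *)
Lemma second_difference_le f x : is_Ck 2 f ->
  exists C d : R, [/\ 0 <= C, 0 < d & forall h, enorm h < d ->
    `|f (x + h) + f (x - h) - 2 * f x| <= C * enorm h ^+ 2].
Proof.
move=> [cf f1].
pose D i := (fun y => 'D_(delta_mx 0 i) f y).
pose DD i j := (fun y => 'D_(delta_mx 0 j) (D i) y).
have df i y : derivable f y (delta_mx 0 i) by have [+ _] := f1 i; exact.
have dD i j y : derivable (D i) y (delta_mx 0 j).
  by have [_ [_ /(_ j)[+ _]]] := f1 i; exact.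
have cDD i j : continuous (DD i j) by have [_ [_ /(_ j)[_]]] := f1 i.
pose M := 1 + \sum_i \sum_j `|DD i j x|.
have M0 : 0 <= M by rewrite addr_ge0// sumr_ge0// => i _; rewrite sumr_ge0.
have MDD i j : `|DD i j x| <= M - 1.
  rewrite /M [1 + _]addrC addrK.
  exact: (@ler_sum2 (fun i j => `|DD i j x|) i j (fun i j => normr_ge0 _)).
have [d d0 dP] : exists2 d : R, 0 < d & forall y, (forall i, `|y 0 i - x 0 i| < d) ->
    forall i j, `|DD i j y| <= M.
  apply: (@nbhs_rV R n x (fun y => forall i j, `|DD i j y| <= M)).
  apply: (@filter_forall _ 'I_n (fun i y => forall j, `|DD i j y| <= M) (nbhs x) _) => i.
  apply: (@filter_forall _ 'I_n (fun j y => `|DD i j y| <= M) (nbhs x) _) => j.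
  have /cvgrPdist_lt/(_ _ ltr01) := cDD i j x; apply: filterS => y xy.
  exact: (ler_norm_near (MDD i j)).
exists (2 * M * n%:R ^+ 2), d; split=> //; first by rewrite !mulr_ge0.
move=> h hd; set e := enorm h.
have he j : `|h 0 j| <= e := ler_norm_enorm h j.
have e0 : 0 <= e by exact: enorm_ge0.
have lip y i : (forall j, `|y 0 j - x 0 j| <= `|h 0 j|) ->
    `|D i y - D i x| <= M * n%:R * e.
  move=> yx; have [eta [etaP]] := MVT_coordinates x (y - x) (dD i).
  rewrite [x + _]addrC subrK => ->.
  apply: (le_trans (ler_norm_sum _ _ _)).
  apply: (@le_trans _ _ (\sum_(j < n) e * M)).
    apply: ler_sum => j _; rewrite normrM ler_pM//.
      by rewrite !mxE (le_trans (yx j)).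
    apply: dP => k; apply: le_lt_trans hd; rewrite (le_trans (etaP j k))//.
    by rewrite !mxE (le_trans (yx k)).
  by rewrite sumr_const card_ord -mulr_natl le_eqVlt; apply/orP; left; apply/eqP; ring.
have [xi [xiP xiE]] := MVT_coordinates x h df.
have [xj [xjP xjE]] := MVT_coordinates x (- h) df.
have -> : f (x + h) + f (x - h) - 2 * f x =
    \sum_(i < n) h 0 i * ((D i (xi i) - D i x) - (D i (xj i) - D i x)).
  transitivity ((f (x + h) - f x) + (f (x - h) - f x)); first by ring.
  rewrite xiE xjE -big_split; apply: eq_bigr => i _ /=.
  by rewrite mxE /D; ring.
apply: (le_trans (ler_norm_sum _ _ _)).
apply: (@le_trans _ _ (\sum_(i < n) e * (2 * M * n%:R * e))).
  apply: ler_sum => i _; rewrite normrM ler_pM//.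
  apply: (le_trans (ler_normB _ _)).
  have l1 := lip (xi i) i (xiP i).
  have l2 : `|D i (xj i) - D i x| <= M * n%:R * e.
    by apply: lip => j; have := xjP i j; rewrite mxE normrN.
  by apply: (le_trans (lerD l1 l2)); rewrite le_eqVlt; apply/orP; left; apply/eqP; ring.
rewrite sumr_const card_ord -[_ *+ n]mulr_natr le_eqVlt; apply/orP; left; apply/eqP; ring.
Qed.

Lemma C2c_bounded u : C2c u -> exists2 M : R, 0 <= M & forall y, `|u y| <= M.
Proof.
move=> [[cu _] ku].
have : compact [set u y | y in closure [set y | u y != 0]].
  by apply: continuous_compact => //; exact: continuous_subspaceT.
move=> /compact_bounded[M [Mr MP]].
exists (`|M| + 1) => [|y]; first by rewrite addr_ge0.
have [->|uy] := eqVneq (u y) 0; first by rewrite normr0 addr_ge0.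
apply: (MP (`|M| + 1)); first by rewrite ltr_pwDr// ler_norm.
by exists y => //; exact: subset_closure.
Qed.

(** Near [x] by Taylor, away from [x] because [u] is bounded. *)
Lemma C2c_second_difference u x : C2c u ->
  exists2 C : R, 0 <= C & forall h,
    `|u (x + h) + u (x - h) - 2 * u x| <= C * Num.min 1 (enorm h ^+ 2).
Proof.
move=> hu; have [M M0 uM] := C2c_bounded hu.
have [C [d [C0 d0 dP]]] := second_difference_le x hu.1.
have u4 h : `|u (x + h) + u (x - h) - 2 * u x| <= 4 * M.
  have := uM (x + h); have := uM (x - h); have := uM x.
  by rewrite !ler_norml => /andP[? ?] /andP[? ?] /andP[? ?]; apply/andP; split; lra.
(* the three terms serve [|h| < d], [d <= |h| < 1] and [1 <= |h|] *)
pose K := C + 4 * M / d ^+ 2 + 4 * M.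
have A0 : 0 <= 4 * M / d ^+ 2 by rewrite divr_ge0 ?mulr_ge0 ?exprn_ge0// ltW.
have K0 : 0 <= K by clear -C0 A0 M0; rewrite /K; lra.
exists K => //.
move=> h; have e0 := enorm_ge0 h; have uh := u4 h; clear u4 uM hu.
have [e1|e1] := leP 1 (enorm h ^+ 2).
  by apply: (le_trans uh); rewrite mulr1 /K; lra.
have [ed|ed] := ltP (enorm h) d.
  apply: (le_trans (dP _ ed)); rewrite ler_wpM2r ?exprn_ge0//.
  by rewrite /K -addrA lerDl addr_ge0// mulr_ge0.
apply: (le_trans uh); apply: (@le_trans _ _ (4 * M / d ^+ 2 * enorm h ^+ 2)).
  rewrite [leRHS]mulrAC ler_pdivlMr ?exprn_gt0//.
  by rewrite ler_wpM2l ?mulr_ge0// ler_sqr ?nnegrE// ltW.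
rewrite ler_wpM2r ?exprn_ge0// /K.
by rewrite addrAC lerDr addr_ge0// mulr_ge0.
Qed.
End second_difference.

(** * The Gamma function and the normalizing constant *)

Section gamma.
Context {R : realType}.
Local Notation mu := (@lebesgue_measure R).
Local Notation mR := (measurableTypeR R).
Local Notation D := (`]0%R, +oo[%classic : set mR).

(** This is [expR (t / p) >= t / p] raised to the power [p]. *)
Lemma powR_le_expR (p t : R) : 0 < p -> 0 <= t -> t `^ p <= p `^ p * expR t.
Proof.
move=> p0 t0.
have -> : t = p * (t / p) by rewrite mulrCA mulfV ?mulr1// gt_eqF.
rewrite powRM ?divr_ge0// ?(ltW p0)//.
rewrite ler_pM2l ?powR_gt0// [p * _]mulrC expRM.
apply: ge0_ler_powR; rewrite ?nnegrE ?expR_ge0 ?divr_ge0// ?(ltW p0)//.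
by apply: le_trans (expR_ge1Dx _); rewrite lerDr.
Qed.

(** Euler's integrand as a Laplace integrand in [z], with rate [ln t]. *)
Lemma Gamma_integrandE (z t : R) : 0 < t ->
  t `^ (z - 1) * expR (- t) = t^-1 * expR (- t) * expR (z * ln t).
Proof.
move=> t0; rewrite powRD ?(gt_eqF t0) ?implybT// powR_inv1 ?(ltW t0)//.
by rewrite /powR (gt_eqF t0); ring.
Qed.

Lemma GammaE (z : R) : Gamma z =
  \int[mu]_(t in D) (t^-1 * expR (- t) * expR (z * ln t)).
Proof.
apply: eq_Rintegral => t; rewrite inE/= in_itv/= andbT => t0.
exact: Gamma_integrandE.
Qed.

Lemma measurable_Gamma_base :
  measurable_fun D (fun t : mR => t^-1 * expR (- t) : R).
Proof.
apply: measurable_funM.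
  apply: open_continuous_measurable_fun; first exact: interval_open.
  move=> t; rewrite inE/= in_itv/= andbT => t0.
  by apply: inv_continuous; rewrite gt_eqF.
apply: measurable_funTS; apply: measurableT_comp => //.
Qed.

(** The weight of parameter [z] has the right singularity at [0], and at infinity
    [expR (- t)] decays faster than any power. *)
Lemma Gamma_integrable (z : R) : 0 < z ->
  mu.-integrable D (fun t => (t^-1 * expR (- t) * expR (z * ln t))%:E).
Proof.
move=> z0.
have mD : measurable D by exact: measurable_itv.
have iw : mu.-integrable D (fun t => (weight z t)%:E).
  apply/integrableP; split.
    apply/measurable_EFinP; apply: measurable_funTS; exact: measurable_weight.
  apply: (le_lt_trans _ (ltry 1)).
  apply: le_trans (integral_weight z0).
  rewrite le_eqVlt; apply/orP; left; apply/eqP; apply: eq_integral => t _ /=.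
  by rewrite ger0_norm// weight_ge0// ltW.
pose C := 1 + (2 * z) `^ (2 * z).
have C1 : 1 <= C by rewrite lerDl powR_ge0.
apply: (le_integrable mD _ _ (integrableZl mD (C * (4 / z)) iw)).
  apply/measurable_EFinP; apply: measurable_funM; first exact: measurable_Gamma_base.
  apply: measurable_funTS; apply: measurableT_comp => //.
  by apply: measurable_funM => //; exact: measurable_ln.
move=> t /=; rewrite in_itv/= andbT => t0.
have w0 : 0 <= 4 / z * weight z t.
  by rewrite mulr_ge0 ?weight_ge0 ?divr_ge0// ltW.
rewrite lee_fin -Gamma_integrandE// ger0_norm ?mulr_ge0 ?powR_ge0 ?expR_ge0//.
rewrite [leRHS]ger0_norm; last by rewrite -mulrA mulr_ge0// (le_trans _ C1).
have [t1|t1] := leP t 1.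
  apply: (@le_trans _ _ (t `^ (z - 1))).
    by rewrite ler_piMr ?powR_ge0// -expR0 ler_expR oppr_le0 ltW.
  rewrite -mulrA; apply: (le_trans (@powR_le_weight01 _ z t z0 _)).
    by rewrite t0.
  by rewrite ler_peMl.
apply: (@le_trans _ _ (C * t `^ (- z - 1))).
  have -> : z - 1 = - z - 1 + 2 * z by ring.
  rewrite [X in X * _]powRD ?(gt_eqF t0) ?implybT// -mulrA mulrC ler_wpM2r ?powR_ge0//.
  rewrite expRN ler_pdivrMr ?expR_gt0//.
  apply: (le_trans (@powR_le_expR (2 * z) t _ _)); rewrite ?mulr_gt0 ?(ltW t0)//.
  by rewrite ler_wpM2r ?expR_ge0// lerDr.
rewrite -mulrA ler_wpM2l ?(le_trans _ C1)//.
by apply: powR_le_weight1y => //; exact: ltW.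
Qed.

(** The integrand is bounded below by a positive constant on [[1, 2]]. *)
Lemma Gamma_gt0 (z : R) : 0 < z -> 0 < Gamma z.
Proof.
move=> z0; rewrite GammaE /Rintegral.
have iG := Gamma_integrable z0.
have mD : measurable D by exact: measurable_itv.
pose f t := t^-1 * expR (- t) * expR (z * ln t).
pose c := expR (- (`|z - 1| * ln 2) - 2).
have /integrableP[mf _] := iG.
have f0 t : D t -> (0 <= (f t)%:E)%E.
  rewrite /= in_itv/= andbT => t0.
  by rewrite lee_fin !mulr_ge0 ?invr_ge0 ?expR_ge0// ltW.
have sub : (`[1, 2]%classic : set mR) `<=` D.
  by move=> t /=; rewrite !in_itv/= andbT => /andP[t1 _]; exact: lt_le_trans t1.
have m12 : measurable (`[1%R, 2%R]%classic : set mR) by exact: measurable_itv.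
suff cf : (c%:E <= \int[mu]_(t in D) (f t)%:E)%E.
  rewrite fine_gt0//; apply/andP; split; last first.
    by rewrite ltey_eq (integrable_fin_num mD iG).
  by apply: lt_le_trans cf; rewrite lte_fin expR_gt0.
apply: (@le_trans _ _ (\int[mu]_(t in `[1%R, 2%R]) (f t)%:E)%E); last first.
  exact: ge0_subset_integral.
apply: (@le_trans _ _ (\int[mu]_(t in `[1%R, 2%R]) c%:E)%E).
  rewrite integral_cst//= lebesgue_measure_itv/= lte_fin ltr1n -EFinB -EFinM lee_fin.
  by rewrite (_ : 2 - 1 = 1) ?mulr1//; ring.
apply: ge0_le_integral => //.
- by move=> t _; rewrite lee_fin expR_ge0.
- by apply: measurable_funS mf.
- move=> t /=; rewrite in_itv/= => /andP[t1 t2].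
  have t0 : 0 < t by exact: lt_le_trans t1.
  rewrite lee_fin /f -Gamma_integrandE// /powR (gt_eqF t0) -expRD ler_expR.
  rewrite lerD ?lerN2//.
  have l0 : 0 <= ln t by exact: ln_ge0.
  have l2 : ln t <= ln 2 by rewrite ler_ln ?posrE.
  apply: (@le_trans _ _ (- (`|z - 1| * ln t))).
    by rewrite lerN2 ler_wpM2l.
  by rewrite -mulNr ler_wpM2r// lerNl -normrN ler_norm.
Qed.

Lemma is_derive_Gamma (z : R) : 0 < z -> is_derive z 1 Gamma
  (\int[mu]_(t in D) (t^-1 * expR (- t) * ln t * expR (z * ln t))).
Proof.
move=> z0; have -> : @Gamma R = fun z =>
    \int[mu]_(t in D) (t^-1 * expR (- t) * expR (z * ln t)).
  by apply/funext => r; exact: GammaE.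
apply: (@laplace_is_derive _ _ _ mu D (fun t => t^-1 * expR (- t)) (@ln R) 0 (z + 1)).
- exact: measurable_itv.
- exact: measurable_Gamma_base.
- by apply: measurable_funTS; exact: measurable_ln.
- by move=> r /andP[r0 _]; exact: Gamma_integrable.
- by rewrite z0 ltrDl ltr01.
Qed.

Lemma derive1_Gamma_continuous (z : R) : 0 < z ->
  {for z, continuous (derive1 (@Gamma R))}.
Proof.
move=> z0.
have c : {for z, continuous (fun z : R =>
    \int[mu]_(t in D) (t^-1 * expR (- t) * ln t * expR (z * ln t)))}.
  apply: (@laplace_derive_continuous _ _ _ mu D (fun t => t^-1 * expR (- t)) (@ln R) 0 (z + 1)).
  - exact: measurable_itv.
  - exact: measurable_Gamma_base.
  - by apply: measurable_funTS; exact: measurable_ln.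
  - by move=> r /andP[r0 _]; exact: Gamma_integrable.
  - by rewrite z0 ltrDl ltr01.
have E (r : R) : 0 < r -> derive1 (@Gamma R) r =
    \int[mu]_(t in D) (t^-1 * expR (- t) * ln t * expR (r * ln t)).
  by move=> r0; rewrite derive1E; have [_ ->] := is_derive_Gamma r0.
rewrite /prop_for /continuous_at E//; apply: cvg_trans c.
apply: near_eq_cvg; near=> r; apply/esym/E.
near: r; exact: lt_nbhsr.
Unshelve. all: by end_near. Qed.

Lemma digamma_continuous (z : R) : 0 < z -> {for z, continuous (@digamma R)}.
Proof.
move=> z0; apply: cvgM; first exact: derive1_Gamma_continuous.
apply: cvgV; first by rewrite gt_eqF// Gamma_gt0.
apply: differentiable_continuous; apply/derivable1_diffP.
by have [] := is_derive_Gamma z0.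
Qed.
End gamma.

Section constants.
Context {R : realType}.
Implicit Types (n : nat) (s : R).

Definition log_derivative_c n s : R :=
  ln 4 + s^-1 + digamma (1 - s) + digamma ((n%:R + 2 * s) / 2).

Lemma c_const_gt0 n s : 0 < s < 1 -> 0 < c_const n s.
Proof.
move=> /andP[s0 s1]; rewrite /c_const !mulr_gt0 ?powR_gt0 ?pi_gt0 ?invr_gt0//.
- by rewrite Gamma_gt0// divr_gt0// ltr_wpDl ?mulr_gt0.
- by rewrite Gamma_gt0// subr_gt0.
Qed.

Let c_const_derive_alg (p q s l a b a' b' : R) : s != 0 -> a != 0 -> b != 0 ->
  p * q * s * (a * (- b ^- 2 * (b' * -1)) + b^-1 * (a' * 1)) +
    a / b * (p * q * 1 + s * (p * 0 + q * (p * l))) =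
  p * q * s * (a / b) * (l + s^-1 + b' / b + a' / a).
Proof. by move=> s0 a0 b0; field; apply/and3P; split. Qed.

Lemma is_derive_c_const n s : 0 < s < 1 ->
  is_derive s 1 (c_const n) (c_const n s * log_derivative_c n s).
Proof.
move=> /andP[s0 s1].
have a0 : 0 < (n%:R + 2 * s) / 2 by rewrite divr_gt0// ltr_wpDl ?mulr_gt0.
have b0 : 0 < 1 - s by rewrite subr_gt0.
pose A (t : R) : R := (n%:R + 2 * t) / 2.
have dA : is_derive s 1 A 1.
  have := is_deriveD (is_derive_cst (n%:R / 2 : R) s 1) (is_derive_id s (1 : R)).
  rewrite add0r; congr is_derive; apply/funext => t.
  by rewrite /A -[LHS]/(n%:R / 2 + t); field.
have dB : is_derive s 1 (fun t : R => 1 - t) (-1).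
  have := is_deriveB (is_derive_cst (1 : R) s 1) (is_derive_id s (1 : R)).
  by rewrite sub0r.
have G1 := is_derive_Gamma a0; have G2 := is_derive_Gamma b0.
have dGE (z r : R) : is_derive z 1 (@Gamma R) r -> r = derive1 Gamma z.
  by move=> [_ <-]; rewrite derive1E.
have E1 := dGE _ _ G1; have E2 := dGE _ _ G2.
rewrite {}E1 in G1; rewrite {}E2 in G2.
have g1 := @is_derive1_comp _ Gamma A s _ _ G1 dA.
have g2 := @is_derive1_comp _ Gamma (fun t : R => 1 - t) s _ _ G2 dB.
have gb0 : Gamma (1 - s) != 0 by rewrite gt_eqF// Gamma_gt0.
have ga0 : Gamma ((n%:R + 2 * s) / 2) != 0 by rewrite gt_eqF// Gamma_gt0.
have g3 := is_deriveM g1 (is_deriveV (f := Gamma \o (fun t : R => 1 - t)) gb0 g2).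
have d2 : is_derive s 1 (fun t : R => 2 `^ (2 * t)) (2 `^ (2 * s) * ln 4).
  have dl : is_derive s 1 (fun t : R => t * (2 * ln 2)) (2 * ln 2).
    have := is_deriveM (is_derive_id s (1 : R)) (is_derive_cst (2 * ln 2 : R) s 1).
    by move/is_derive_eq; apply; rewrite /GRing.scale/= mulr0 mulr1 add0r.
  have := @is_derive1_comp _ expR (fun t : R => t * (2 * ln 2)) s _ _
    (is_derive_expR _) dl.
  have -> : ln 4 = 2 * ln 2 :> R.
    have -> : 4 = 2 * 2 :> R by ring.
    by rewrite lnM ?posrE//; ring.
  have E t : 2 `^ (2 * t) = expR (t * (2 * ln 2)) :> R.
    by rewrite /powR pnatr_eq0/=; congr expR; ring.
  rewrite E; congr is_derive; apply/funext => t; by rewrite E.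
have d3 := is_deriveM (is_deriveM (is_deriveM d2
  (is_derive_cst (pi `^ (- (n%:R / 2)) : R) s 1)) (is_derive_id s (1 : R))) g3.
apply: (is_derive_eq d3).
rewrite /c_const /log_derivative_c /digamma /GRing.scale /= /A.
rewrite -![(_ * _ : R -> R) s]/(_ s * _ s) /cst /=.
exact: (c_const_derive_alg _ _ _ _ _ (lt0r_neq0 s0) ga0 gb0).
Qed.

Lemma is_derive_ln_c_const n s : 0 < s < 1 ->
  is_derive s 1 (fun t => ln (c_const n t)) (log_derivative_c n s).
Proof.
move=> s01; have c0 := c_const_gt0 n s01.
have := is_derive1_comp (is_derive1_ln c0) (is_derive_c_const n s01).
by move/is_derive_eq; apply; rewrite mulrA mulVf ?mul1r// gt_eqF.
Qed.

Lemma log_derivative_c_continuous n s : 0 < s < 1 ->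
  {for s, continuous (log_derivative_c n)}.
Proof.
move=> /andP[s0 s1].
have a0 : 0 < (n%:R + 2 * s) / 2 by rewrite divr_gt0// ltr_wpDl ?mulr_gt0.
have b0 : 0 < 1 - s by rewrite subr_gt0.
apply: cvgD; first apply: cvgD; first apply: cvgD.
- exact: cvg_cst.
- by apply: inv_continuous; rewrite gt_eqF.
- apply: (@continuous_comp _ _ _ (fun t : R => 1 - t) digamma).
    by apply: cvgB; [exact: cvg_cst | exact: cvg_id].
  exact: digamma_continuous.
- apply: (@continuous_comp _ _ _ (fun t : R => (n%:R + 2 * t) / 2) digamma).
    apply: cvgMl; apply: cvgD; first exact: cvg_cst.
    by apply: cvgMr; exact: cvg_id.
  exact: digamma_continuous.
Qed.
End constants.

(** * The fractional Laplacian *)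

Section fractional.
Context {R : realType}.
Local Notation mR := (measurableTypeR R).
Context (n : nat) (u : 'rV[R]_n -> R) (x : 'rV[R]_n).
Context (n_gt0 : (0 < n)%N) (uC2 : C2c u).
Local Notation mu := (@lebesgue_tuple R n).
Implicit Types (t : R) (y : 'rV[R]_n) (tau : n.-tuple mR).

Let n0 : (0 : R) < n%:R. Proof. by rewrite ltr0n. Qed.

(** The singularity at [0] has exponent [2 - 2t - n] and the decay at infinity
    exponent [- 2t - n]. A common exponent [b <= min (2t) (2 - 2t)], [b <= 1], is
    distributed evenly over the [n] coordinates. *)
Lemma Riesz_kernel_le_weight t : 0 < t < 1 ->
  exists a C : R, [/\ 0 < a <= 1, 0 <= C & forall r : R, 0 < r ->
    Num.min 1 (r ^+ 2) * r `^ (- (n%:R + 2 * t)) <= C * weight a r ^+ n].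
Proof.
(* [2 t (1 - t)] is below [2 t], [2 (1 - t)] and [1] at the same time *)
move=> /andP[t0 t1]; pose b := 2 * t * (1 - t); pose a := b / n%:R.
have b0 : 0 < b by rewrite /b; nra.
have b1 : b <= 1 by rewrite /b; nra.
have b2 : b <= 2 * t by rewrite /b; nra.
have b3 : b <= 2 - 2 * t by rewrite /b; nra.
have a0 : 0 < a by rewrite divr_gt0.
have a1 : a <= 1.
  by rewrite ler_pdivrMr// mul1r (le_trans b1)// ler1n.
have an : a * n%:R = b by rewrite divfK// gt_eqF.
exists a, ((4 / a) ^+ n); split; first by rewrite a0.
  by rewrite exprn_ge0// divr_ge0// ltW.
move=> r r0; have [r1|r1] := leP r 1.
- rewrite -exprMn; apply: (@le_trans _ _ ((r `^ (a - 1)) ^+ n)); last first.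
    have r01 : 0 < r <= 1 by rewrite r0.
    have w := powR_le_weight01 a0 r01.
    by rewrite lerXn2r ?nnegrE ?powR_ge0// (le_trans _ w) ?powR_ge0.
  rewrite -(powR_mulrn n (powR_ge0 _ _)) -powRrM mulrBl an mul1r.
  apply: (@le_trans _ _ (r ^+ 2 * r `^ (- (n%:R + 2 * t)))).
    by rewrite ler_wpM2r ?powR_ge0// ge_min lexx orbT.
  rewrite -(powR_mulrn 2 (ltW r0)) -powRD ?(gt_eqF r0) ?implybT//.
  by apply: ger_powR; rewrite ?r0//; lra.
- rewrite -exprMn; apply: (@le_trans _ _ ((r `^ (- a - 1)) ^+ n)); last first.
    have w := powR_le_weight1y a0 (ltW r1).
    by rewrite lerXn2r ?nnegrE ?powR_ge0// (le_trans _ w) ?powR_ge0.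
  rewrite -(powR_mulrn n (powR_ge0 _ _)) -powRrM mulrBl mulNr an mul1r.
  apply: (@le_trans _ _ (r `^ (- (n%:R + 2 * t)))).
    by rewrite ler_piMl ?powR_ge0// ge_min lexx.
  by apply: ler_powR; [exact: ltW | lra].
Qed.

Definition base_kernel y : R := (u x - u y) * enorm (x - y) `^ (- n%:R).
Definition log_rate y : R := - 2 * ln (enorm (x - y)).

(** At [y = x] both sides vanish: a negative power of [0] is [0]. *)
Lemma powR_log_rate t y : 0 < t ->
  enorm (x - y) `^ (- n%:R) * expR (t * log_rate y) =
  enorm (x - y) `^ (- (n%:R + 2 * t)).
Proof.
move=> t0; rewrite /log_rate.
have := enorm_ge0 (x - y); rewrite le_eqVlt => /predU1P[<-|e0].
  rewrite !powR0 ?mul0r ?oppr_eq0 ?gt_eqF//.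
  by rewrite addr_gt0// mulr_gt0.
rewrite (opprD n%:R) powRD ?(gt_eqF e0) ?implybT//; congr (_ * _).
by rewrite [RHS]/powR (gt_eqF e0); congr expR; ring.
Qed.

Lemma frac_kernelE t y : 0 < t ->
  frac_kernel t u x y = base_kernel y * expR (t * log_rate y).
Proof.
by move=> t0; rewrite /frac_kernel /base_kernel -mulrA powR_log_rate// powRN.
Qed.

Lemma log_kernelE t y : 0 < t ->
  log_kernel t u x y = base_kernel y * log_rate y * expR (t * log_rate y).
Proof. by move=> t0; rewrite /log_kernel frac_kernelE// mulrAC. Qed.

Lemma log_rate_reflect y : log_rate (2 *: x - y) = log_rate y.
Proof. by rewrite /log_rate enorm_reflect. Qed.

Lemma symmetrize_frac_kernel t y : 0 < t ->
  symmetrize x (frac_kernel t u x) y =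
  symmetrize x base_kernel y * expR (t * log_rate y).
Proof.
by move=> t0; rewrite /symmetrize !frac_kernelE// log_rate_reflect -mulrDl mulrAC.
Qed.

Lemma symmetrize_log_kernel t y : 0 < t ->
  symmetrize x (log_kernel t u x) y =
  symmetrize x base_kernel y * log_rate y * expR (t * log_rate y).
Proof.
move=> t0; rewrite /symmetrize (log_kernelE y t0) (log_kernelE (2 *: x - y) t0).
rewrite log_rate_reflect.
have sumE (a b c d : R) : (a * c * d + b * c * d) / 2 = (a + b) / 2 * c * d by ring.
exact: sumE.
Qed.

Lemma measurable_log_rate :
  measurable_fun setT (fun tau => log_rate (vec_of_tuple tau)).
Proof.
apply: measurable_funM => //.
by apply: measurableT_comp; [exact: measurable_ln | exact: measurable_enorm].
Qed.

Lemma measurable_base_kernel :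
  measurable_fun setT (fun tau => base_kernel (vec_of_tuple tau)).
Proof.
apply: measurable_funM.
  apply: measurable_funB => //; apply: measurable_continuous_vec.
  by case: uC2 => -[].
apply: (measurableT_comp (measurable_powR (- n%:R : R))).
exact: measurable_enorm.
Qed.

Lemma symmetrize_base_kernelE y : symmetrize x base_kernel y =
  (2 * u x - u y - u (2 *: x - y)) / 2 * enorm (x - y) `^ (- n%:R).
Proof.
rewrite /symmetrize /base_kernel enorm_reflect -mulrDl mulrAC; congr (_ / _ * _).
by ring.
Qed.

Lemma measurable_symmetrize_base_kernel :
  measurable_fun setT (fun tau => symmetrize x base_kernel (vec_of_tuple tau)).
Proof.
rewrite (_ : (fun _ => _) = fun tau => (2 * u x - u (vec_of_tuple tau) -
    (u \o (fun y => 2 *: x - y)) (vec_of_tuple tau)) / 2 *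
    enorm (x - vec_of_tuple tau) `^ (- n%:R)); last first.
  by apply/funext => tau; rewrite symmetrize_base_kernelE.
have cu : continuous u by case: uC2 => -[].
apply: measurable_funM.
  apply: measurable_funM => //; apply: measurable_funB.
    by apply: measurable_funB => //; exact: measurable_continuous_vec.
  apply: measurable_continuous_vec => y.
  apply: continuous_comp; last exact: cu.
  exact: (@continuousB _ _ _ (cst (2 *: x)) id y (@cst_continuous _ _ _ y)).
apply: (measurableT_comp (measurable_powR (- n%:R : R))).
exact: measurable_enorm.
Qed.

Lemma integrable_kernel t (g : 'rV[R]_n -> R) (K : R) (D : set (n.-tuple mR)) :
  0 < t < 1 -> 0 <= K -> measurable D ->
  measurable_fun setT (fun tau => g (vec_of_tuple tau)) ->
  (forall tau, D tau -> `|g (vec_of_tuple tau)| <=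
     K * Num.min 1 (enorm (x - vec_of_tuple tau) ^+ 2) *
     enorm (x - vec_of_tuple tau) `^ (- n%:R)) ->
  mu.-integrable D (fun tau => (g (vec_of_tuple tau) *
    expR (t * log_rate (vec_of_tuple tau)))%:E).
Proof.
move=> t01 K0 mD mg gle; have /andP[t0 _] := t01.
have [a [C [a01 C0 CP]]] := Riesz_kernel_le_weight t01.
apply: (@integrable_le_weight R n x a (K * C)) => //.
- exact: mulr_ge0.
- apply: measurable_funTS; apply: measurable_funM => //.
  apply: measurableT_comp => //.
  by apply: measurable_funM => //; exact: measurable_log_rate.
move=> tau Dtau; rewrite normrM (ger0_norm (expR_ge0 _)).
apply: (le_trans (ler_wpM2r (expR_ge0 _) (gle _ Dtau))).
rewrite -[leLHS]mulrA (powR_log_rate _ t0) -[leLHS]mulrA -[leRHS]mulrA.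
rewrite ler_wpM2l//.
have := enorm_ge0 (x - vec_of_tuple tau); rewrite le_eqVlt => /predU1P[<-|e0].
  rewrite powR0 ?mulr0.
    rewrite mulr_ge0// exprn_ge0// weight_ge0//.
    by case/andP: a01 => /ltW.
  by rewrite oppr_eq0 gt_eqF// addr_gt0// mulr_gt0.
exact: CP.
Qed.

(** Away from [x] the boundedness of [u] suffices, because [min 1 r^2] is
    bounded below there. *)
Lemma integrable_base_kernel t e : 0 < t < 1 -> 0 < e ->
  mu.-integrable (outside_ball x e) (fun tau => (base_kernel (vec_of_tuple tau) *
    expR (t * log_rate (vec_of_tuple tau)))%:E).
Proof.
move=> t01 e0; have [M M0 uM] := C2c_bounded uC2.
have m0 : 0 < Num.min 1 (e ^+ 2) by rewrite lt_min ltr01 exprn_gt0.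
apply: (@integrable_kernel t base_kernel (2 * M / Num.min 1 (e ^+ 2))) => //.
- by rewrite divr_ge0 ?mulr_ge0// ltW.
- exact: measurable_outside_ball.
- exact: measurable_base_kernel.
move=> tau; rewrite /outside_ball /= => er.
rewrite normrM (ger0_norm (powR_ge0 _ _)) ler_wpM2r ?powR_ge0//.
apply: (@le_trans _ _ (2 * M)).
  by apply: (le_trans (ler_normB _ _)); rewrite mulr2n mulrDl mul1r lerD.
rewrite mulrAC ler_pdivlMr// ler_wpM2l ?mulr_ge0//.
rewrite le_min !ge_min lexx/=; apply/orP; right.
by rewrite ler_sqr ?nnegrE ?enorm_ge0// ltW.
Qed.

(** Here the second difference compensates the singularity at [x]. *)
Lemma integrable_symmetrize_base_kernel t : 0 < t < 1 ->
  mu.-integrable setT (fun tau => (symmetrize x base_kernel (vec_of_tuple tau) *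
    expR (t * log_rate (vec_of_tuple tau)))%:E).
Proof.
move=> t01; have [C C0 uC] := C2c_second_difference x uC2.
apply: (@integrable_kernel t (symmetrize x base_kernel) C) => //.
  exact: measurable_symmetrize_base_kernel.
move=> tau _; rewrite symmetrize_base_kernelE normrM (ger0_norm (powR_ge0 _ _)).
rewrite ler_wpM2r ?powR_ge0//.
set y := vec_of_tuple tau.
have := uC (x - y); rewrite opprB [x + (y - x)]addrC subrK.
have -> : x + (x - y) = 2 *: x - y by rewrite scaler_nat mulr2n addrA.
rewrite normrM -normrN.
have -> : - (u (2 *: x - y) + u y - 2 * u x) = 2 * u x - u y - u (2 *: x - y) by ring.
move=> h; apply: le_trans h; rewrite ler_piMr//.
by rewrite ger0_norm ?invr_ge0// invf_le1// ler1n.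
Qed.

(** The absolutely convergent integrals that replace the principal values
    of [frac_kernel] and [log_kernel]. *)
Definition sym_integral t : R := \int[mu]_tau
  (symmetrize x base_kernel (vec_of_tuple tau) *
   expR (t * log_rate (vec_of_tuple tau))).

Definition sym_log_integral t : R := \int[mu]_tau
  (symmetrize x base_kernel (vec_of_tuple tau) * log_rate (vec_of_tuple tau) *
   expR (t * log_rate (vec_of_tuple tau))).

Lemma pv_frac_kernel t : 0 < t < 1 ->
  pv_exists (frac_kernel t u x) x /\
  pv_integral (frac_kernel t u x) x = sym_integral t.
Proof.
move=> t01; have /andP[t0 _] := t01.
have k0 : frac_kernel t u x x = 0 by rewrite /frac_kernel subrr mul0r.
have k1 e : 0 < e -> mu.-integrable (outside_ball x e)
    (fun tau => (frac_kernel t u x (vec_of_tuple tau))%:E).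
  move=> e0; have := integrable_base_kernel t01 e0; apply: eq_integrable.
    exact: measurable_outside_ball.
  by move=> tau _; rewrite frac_kernelE.
have k2 : mu.-integrable setT
    (fun tau => (symmetrize x (frac_kernel t u x) (vec_of_tuple tau))%:E).
  have := integrable_symmetrize_base_kernel t01; apply: eq_integrable => //.
  by move=> tau _; rewrite symmetrize_frac_kernel.
have [pv ->] := pv_symmetrize k0 k1 k2.
by split=> //; apply: eq_Rintegral => tau _; rewrite symmetrize_frac_kernel.
Qed.

Lemma pv_log_kernel t : 0 < t < 1 ->
  pv_exists (log_kernel t u x) x /\
  pv_integral (log_kernel t u x) x = sym_log_integral t.
Proof.
move=> t01; have /andP[t0 _] := t01.
have k0 : log_kernel t u x x = 0.
  by rewrite /log_kernel /frac_kernel subrr !mul0r.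
have k1 e : 0 < e -> mu.-integrable (outside_ball x e)
    (fun tau => (log_kernel t u x (vec_of_tuple tau))%:E).
  move=> e0; have mo := @measurable_outside_ball R n x e.
  have := @laplace_integrable _ _ _ mu _ _ _ 0 1 t mo
    (measurable_funTS measurable_base_kernel) (measurable_funTS measurable_log_rate)
    (fun r r01 => integrable_base_kernel r01 e0) t01.
  by apply: eq_integrable => // tau _; rewrite log_kernelE.
have k2 : mu.-integrable setT
    (fun tau => (symmetrize x (log_kernel t u x) (vec_of_tuple tau))%:E).
  have := @laplace_integrable _ _ _ mu _ _ _ 0 1 t measurableT
    measurable_symmetrize_base_kernel measurable_log_rate
    integrable_symmetrize_base_kernel t01.
  by apply: eq_integrable => // tau _; rewrite symmetrize_log_kernel.
have [pv ->] := pv_symmetrize k0 k1 k2.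
by split=> //; apply: eq_Rintegral => tau _; rewrite symmetrize_log_kernel.
Qed.

Lemma is_derive_sym_integral t : 0 < t < 1 ->
  is_derive t 1 sym_integral (sym_log_integral t).
Proof.
exact: (@laplace_is_derive _ _ _ mu _ _ _ 0 1 t measurableT
    measurable_symmetrize_base_kernel measurable_log_rate
    integrable_symmetrize_base_kernel).
Qed.

Lemma sym_log_integral_continuous t : 0 < t < 1 ->
  {for t, continuous sym_log_integral}.
Proof.
exact: (@laplace_derive_continuous _ _ _ mu _ _ _ 0 1 t measurableT
    measurable_symmetrize_base_kernel measurable_log_rate
    integrable_symmetrize_base_kernel).
Qed.

(** The principal value is the integral [sym_integral] only for parameters in
    (0, 1), whence the passage to a neighbourhood of [t]. *)
Lemma is_derive_frac_laplacian t : 0 < t < 1 ->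
  is_derive t 1 (fun r => frac_laplacian r u x)
    (c_const n t * sym_log_integral t +
     log_derivative_c n t * (c_const n t * sym_integral t)).
Proof.
move=> t01.
have d := is_deriveM (is_derive_c_const n t01) (is_derive_sym_integral t01).
apply: (@near_eq_is_derive _ _ _ (c_const n * sym_integral)).
  have : t \in `]0, 1[ by rewrite in_itv.
  move/near_in_itvoo; apply: filterS => r; rewrite in_itv/= => r01.
  by rewrite /frac_laplacian (pv_frac_kernel r01).2.
by apply: (is_derive_eq d); rewrite /GRing.scale/=; ring.
Qed.

Lemma derive1_frac_laplacian_continuous t : 0 < t < 1 ->
  {for t, continuous (derive1 (fun r => frac_laplacian r u x))}.
Proof.
move=> t01.
have dE r : 0 < r < 1 -> derive1 (fun r => frac_laplacian r u x) r =
    c_const n r * sym_log_integral r +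
     log_derivative_c n r * (c_const n r * sym_integral r).
  by move=> r01; rewrite derive1E; have [_ ->] := is_derive_frac_laplacian r01.
have dcont (f : R -> R) df : is_derive t 1 f df -> {for t, continuous f}.
  by move=> [? _]; apply: differentiable_continuous; apply/derivable1_diffP.
have c : {for t, continuous (fun r => c_const n r * sym_log_integral r +
     log_derivative_c n r * (c_const n r * sym_integral r))}.
  have cc := dcont _ _ (is_derive_c_const n t01).
  apply: cvgD.
    by apply: cvgM; [exact: cc | exact: sym_log_integral_continuous].
  apply: cvgM; first exact: log_derivative_c_continuous.
  by apply: cvgM; [exact: cc | exact: dcont _ _ (is_derive_sym_integral t01)].
rewrite /prop_for /continuous_at dE//; apply: cvg_trans c.
apply: near_eq_cvg; have : t \in `]0, 1[ by rewrite in_itv.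
by move/near_in_itvoo; apply: filterS => r; rewrite in_itv/= => r01; rewrite dE.
Qed.
End fractional.

Unset Implicit Arguments.

Theorem proposition1p1 (R : realType) (n : nat) (hn : (1 <= n)%N)
    (s : R) (hs0 : 0 < s) (hs1 : s < 1)
    (u : 'rV[R]_n -> R) (hu : C2c u) (x : 'rV[R]_n) :
  [/\ (* the map t |-> (-Delta)^t u(x) is well defined and C^1 on (0,1) *)
      (forall t : R, 0 < t < 1 -> pv_exists (frac_kernel t u x) x),
      (forall t : R, 0 < t < 1 ->
         derivable (fun r : R => frac_laplacian r u x) t 1 /\
         {for t, continuous (derive1 (fun r : R => frac_laplacian r u x))}),
      (* the derivative at s *)
      pv_exists (log_kernel s u x) x,
      derive1 (fun t : R => frac_laplacian t u x) s
        = c_const n s * L1_op s u x + b_const n s * frac_laplacian s u x &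
      (* the formula for b_{n,s} = d/ds ln c_{n,s} *)
      derivable (fun t : R => ln (c_const n t)) s 1 /\
      b_const n s = ln 4 + s^-1 + digamma (1 - s) + digamma ((n%:R + 2 * s) / 2)].
Proof.
have s01 : 0 < s < 1 by rewrite hs0.
have [dln lnE] := is_derive_ln_c_const n s01.
have bE : b_const n s = log_derivative_c n s by rewrite /b_const derive1E.
split.
- by move=> t t01; have [] := pv_frac_kernel x hn hu t01.
- move=> t t01; split; last exact: derive1_frac_laplacian_continuous.
  by have [] := is_derive_frac_laplacian x hn hu t01.
- by have [] := pv_log_kernel x hn hu s01.
- rewrite derive1E; have [_ ->] := is_derive_frac_laplacian x hn hu s01.
  rewrite bE /L1_op /frac_laplacian.
  by rewrite (pv_frac_kernel x hn hu s01).2 (pv_log_kernel x hn hu s01).2.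
- by split.
Qed.
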